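(* For any $\delta t>0$ and any mesh size $h=L/N$, the fully discrete scheme $$\frac{c^{n+1}-c^n}{\delta t}=-\hat{\mathscr{G}}\Big(\frac{\partial\Xi}{\partial c}(c^{n+1},Q^{n+1})+2(c_{00}-\gamma)c^n+L_c[c^{n+1},Q^{n+1}]\Big)\quad\text{at interior nodes},$$ $$\frac{Q_{ij}^{n+1}-Q_{ij}^n}{\delta t}=-\mathscr{P}\Big(\frac{\partial\Xi}{\partial Q_{ij}}(c^{n+1},Q^{n+1})+2c_{02}Q_{ij}^n+L_{Q_{ij}}[c^{n+1},Q^{n+1}]\Big)\quad\text{at interior nodes},$$ $$\frac{D_{\mathbf n}c^{n+1}-D_{\mathbf n}c^n}{\delta t}=-\Delta_hc^{n+1}\quad\text{on }\partial\Omega\text{ (boundary nodes)},$$ with prescribed values of $c^{n+1},Q^{n+1}$ on the boundary nodes, has a unique solution $(c^{n+1},Q^{n+1},D_{\mathbf n}c^{n+1})$. Moreover, it satisfies the discrete energy law $$\hat E[c^{n+1},Q^{n+1}]+h^2\Big[\frac{1-(c_{00}-\gamma)\delta t}{\delta t}\sum_P(c^{n+1}-c^n)_P^2+\frac{1-c_{02}\delta t}{\delta t}\sum_P(Q^{n+1}_{ij}-Q^n_{ij})_P^2\Big]$$ $$+\hat E_+(c^{n+1}-c^n,Q^{n+1}-Q^n)+2c_{40}\frac h{\delta t}\sum_\sigma(D_{\mathbf n}c^{n+1}-D_{\mathbf n}c^n)^2_\sigma\le\hat E[c^n,Q^n].$$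
   Context: Grid: $\Omega=[0,L]^2$ is divided uniformly into $N^2$ square cells of side $h=L/N$. Node $(l,m)$ is the point $(lh,mh)$, $0\le l,m\le N$; it is interior if $1\le l,m\le N-1$, otherwise a boundary node. $\Gamma_{l,m}$ is the cell with lower-left node $(l,m)$, $0\le l,m\le N-1$. Boundary cells $\sigma$ are the $4N$ grid edges on $\partial\Omega$. Ghost nodes $(-1,m),(N+1,m),(l,-1),(l,N+1)$ carry values of $c$; discrete normal derivatives are $(D^x_{\mathbf n}v)_{0,m}=\frac{v_{-1,m}-v_{1,m}}{2h}$, $(D^x_{\mathbf n}v)_{N,m}=\frac{v_{N+1,m}-v_{N-1,m}}{2h}$, $(D^y_{\mathbf n}v)_{l,0}=\frac{v_{l,-1}-v_{l,1}}{2h}$, $(D^y_{\mathbf n}v)_{l,N}=\frac{v_{l,N+1}-v_{l,N-1}}{2h}$, and serve as independent variables in place of ghost values. $D_{\mathbf n}$ means $D^x_{\mathbf n}$ on vertical sides, $D^y_{\mathbf n}$ on horizontal sides (at a corner both occur, and the boundary equation is imposed for each). $\sum_P$ sums over interior nodes; $\sum_\Gamma$ over all cells; $\sum_\sigma u_\sigma$ sums over boundary cells, $u_\sigma$ being the average of $u$ over the two endpoints (in $(D_{\mathbf n}u)^2_\sigma$, the average of the squares). Differences at nodes: $(D_{11}u)_{l,m}=h^{-2}(u_{l-1,m}-2u_{l,m}+u_{l+1,m})$, $D_{22}$ similarly in $m$; $(D_{12}u)_{l,m}=(D_{21}u)_{l,m}=\frac{1}{4h^2}(u_{l-1,m-1}+u_{l+1,m+1}-u_{l-1,m+1}-u_{l+1,m-1})$;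 $D_{1111}=D_{11}D_{11}$, $D_{1122}=D_{11}D_{22}$, $D_{2222}=D_{22}D_{22}$; $\Delta_h=D_{11}+D_{22}$, $\Delta_h^2=D_{1111}+2D_{1122}+D_{2222}$. Products on a cell $\Gamma=\Gamma_{l,m}$: $(D_1uD_1v)_\Gamma=\frac1{2h^2}[(u_{l+1,m}-u_{l,m})(v_{l+1,m}-v_{l,m})+(u_{l+1,m+1}-u_{l,m+1})(v_{l+1,m+1}-v_{l,m+1})]$, $(D_2uD_2v)_\Gamma$ analogously with the roles of the directions exchanged; $(D_1uD_2v)_\Gamma=\frac1{4h^2}(u_{l+1,m+1}+u_{l+1,m}-u_{l,m+1}-u_{l,m})(v_{l+1,m+1}-v_{l+1,m}+v_{l,m+1}-v_{l,m})$, and $(D_2uD_1v)_\Gamma=(D_1vD_2u)_\Gamma$; products of node-defined quantities such as $((\Delta_hu)^2)_\Gamma$ are the average of the product over the four nodes of $\Gamma$. Products of sums are expanded bilinearly; repeated indices are summed. Quasi-entropy: $M,\nu>0$; $q(S)=-\log\det(S+I/2)+\log\det(I/2)$ for symmetric traceless $2\times 2$ $S$ with eigenvalues in $(-1/2,1/2)$; $\Xi(c,Q)=c\log c+(M-c)\log(1-c/M)+c\nu q(Q/c)$. Its derivatives $\frac{\partial\Xi}{\partial c}=\log\frac{Mc}{M-c}+\nu q(Q/c)+\frac\nu c(\frac Qc+\frac I2)^{-1}_{ij}Q_{ij}$, $\frac{\partial\Xi}{\partial Q_{ij}}=-\nu(\frac Qc+\frac I2)^{-1}_{ij}$ are defined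 only on $(\mathcal{Q}_{\mathrm{phys}}^M)^\circ=\{(c,Q):0<c<M,\ Q=Q^t,\ \mathrm{tr}\,Q=0,\ \text{eigenvalues of }Q\text{ in }(-c/2,c/2)\}$, so a solution of the scheme has interior-node values in this set. The given previous step $(c^n,Q^n,D_{\mathbf n}c^n)$ has interior-node values in this set and the same prescribed boundary-node values. Operators: $L_c[c,Q]=2\gamma c-2c_{20}D_{kk}c-c_{23}D_{ij}Q_{ij}+2c_{40}\Delta_h^2c$; $L_{Q_{ij}}[c,Q]=-2c_{21}D_{kk}Q_{ij}-2c_{22}D_{ik}Q_{kj}-c_{23}D_{ij}c$; $\hat{\mathscr{G}}A=A-\frac1{\#P}\sum_PA_P$ with $\#P$ the number of interior nodes; $(\mathscr{P}Q)_{ij}=\frac12(Q_{ij}+Q_{ji})-\frac12\delta_{ij}Q_{kk}$. Discrete energy: $\hat E(c,Q)=h^2\sum_P\big(\Xi(c,Q)\big)_P+\hat E_+(c,Q)-\hat E_-(c,Q)+A$, with $A$ a constant determined by the boundary-node values, $$\hat E_+(c,Q)=h^2\sum_\Gamma\Big(c_{20}D_icD_ic+c_{21}D_iQ_{jk}D_iQ_{jk}+c_{22}D_iQ_{ij}D_kQ_{kj}+c_{23}D_jcD_iQ_{ij}+c_{40}(\Delta_hc)^2\Big)_\Gamma+h^2\sum_P(\gamma c^2)_P,$$ $$\hat E_-(c,Q)=h^2\sum_P\big(-(c_{00}-\gamma)c^2-c_{02}Q_{ij}Q_{ij}\big)_P.$$ Coefficients are real with $c_{40},c_{21},c_{22}>0$,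 $c_{20}<0$; $\gamma\ge c_{00}$ and $\gamma\ge\big(\min\{c_{20}-\frac{c_{23}^2}{4c_{22}},0\}\big)^2/(4c_{40})$. *)

(* Defs.v *)
From HB Require Import structures.
From mathcomp Require Import all_boot all_order all_algebra.
From mathcomp Require Import reals exp.
Set Implicit Arguments.
Unset Strict Implicit.
Unset Printing Implicit Defensive.
Import Order.TTheory GRing.Theory Num.Theory.
Local Open Scope ring_scope.

(* A grid function is indexed by all of int * int. For c only the values at
   the nodes and at the ghost nodes matter, for Q only those at the nodes; no
   definition below reads any other value. The normal derivatives are an
   affine reparametrization of the ghost values, given the node values.
   Tensor indices are in 'I_2: the index 0 is the first direction (l), the
   index 1 the second one (m). *)
Definition gridfun (T : Type) := int -> int -> T.

Definition gsub (V : zmodType) (u v : gridfun V) : gridfun V :=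
  fun l m => u l m - v l m.

Definition comp (R : realType) (Q : gridfun 'M[R]_2) (i j : 'I_2) : gridfun R :=
  fun l m => Q l m i j.

Record coeffs (R : realType) := Coeffs {
  c00 : R; c02 : R; c20 : R; c21 : R; c22 : R; c23 : R; c40 : R;
  gamma : R;
  cmax : R; (* the upper bound M of the concentration *)
  nu : R }.

Definition admissible (R : realType) (k : coeffs R) : Prop :=
  [/\ 0 < cmax k /\ 0 < nu k,
      [/\ 0 < c40 k, 0 < c21 k & 0 < c22 k],
      c20 k < 0,
      c00 k <= gamma k &
      (Num.min (c20 k - c23 k ^+ 2 / (4 * c22 k)) 0) ^+ 2 / (4 * c40 k)
        <= gamma k].

Section QuasiEntropy.
Variables (R : realType) (k : coeffs R).

Definition half_id : 'M[R]_2 := (1 / 2)%:M.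

Definition qent (S : 'M[R]_2) : R := - ln (\det (S + half_id)) + ln (\det half_id).

Definition Xi (c : R) (Q : 'M[R]_2) : R :=
  c * ln c + (cmax k - c) * ln (1 - c / cmax k) + c * nu k * qent (c^-1 *: Q).

Definition physical (c : R) (Q : 'M[R]_2) : Prop :=
  [/\ 0 < c < cmax k, Q = Q^T, \tr Q = 0 &
      forall a : R, eigenvalue Q a -> - (c / 2) < a < c / 2].

(* The partial derivatives of Xi, meaningful where [physical c Q] holds; the
   entries of Q are differentiated as independent variables. *)
Definition dXi_dc (c : R) (Q : 'M[R]_2) : R :=
  ln (cmax k * c / (cmax k - c)) + nu k * qent (c^-1 *: Q)
  + nu k / c * \sum_(i < 2) \sum_(j < 2) invmx (c^-1 *: Q + half_id) i j * Q i j.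

Definition dXi_dQ (c : R) (Q : 'M[R]_2) (i j : 'I_2) : R :=
  - nu k * invmx (c^-1 *: Q + half_id) i j.

End QuasiEntropy.

Section Grid.
Variables (R : realType) (N : nat).

Definition is_node (l m : int) : bool :=
  (0 <= l <= N%:Z) && (0 <= m <= N%:Z).

Definition interior (l m : int) : bool :=
  (1 <= l <= N%:Z - 1) && (1 <= m <= N%:Z - 1).

Definition bnode (l m : int) : bool := is_node l m && ~~ interior l m.

Definition sumP (f : gridfun R) : R :=
  \sum_(1 <= l < N) \sum_(1 <= m < N) f l%:Z m%:Z.

Definition cardP : nat := (N.-1 * N.-1)%N.

Definition sumCell (f : gridfun R) : R :=
  \sum_(0 <= l < N) \sum_(0 <= m < N) f l%:Z m%:Z.

(* Sum over boundary edges of the endpoint averages; [fx] is used on the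
   vertical sides and [fy] on the horizontal ones, so a corner contributes
   through both. *)
Definition sumEdge (fx fy : gridfun R) : R :=
  \sum_(0 <= m < N) ((fx 0 m%:Z + fx 0 (m%:Z + 1)) / 2
                     + (fx N%:Z m%:Z + fx N%:Z (m%:Z + 1)) / 2)
  + \sum_(0 <= l < N) ((fy l%:Z 0 + fy (l%:Z + 1) 0) / 2
                       + (fy l%:Z N%:Z + fy (l%:Z + 1) N%:Z) / 2).

Definition Ghat (A : gridfun R) : gridfun R :=
  fun l m => A l m - sumP A / cardP%:R.

End Grid.

Definition symtl (R : realType) (A : 'M[R]_2) : 'M[R]_2 :=
  \matrix_(i, j) ((A i j + A j i) / 2 - (i == j)%:R / 2 * \sum_(k < 2) A k k).

Section Differences.
Variables (R : realType) (h : R).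
Implicit Types u v : gridfun R.

Definition D11 u : gridfun R := fun l m =>
  (u (l - 1) m - 2 * u l m + u (l + 1) m) / h ^+ 2.

Definition D22 u : gridfun R := fun l m =>
  (u l (m - 1) - 2 * u l m + u l (m + 1)) / h ^+ 2.

Definition D12 u : gridfun R := fun l m =>
  (u (l - 1) (m - 1) + u (l + 1) (m + 1)
   - u (l - 1) (m + 1) - u (l + 1) (m - 1)) / (4 * h ^+ 2).

Definition DD (i j : 'I_2) u : gridfun R :=
  if i == j then (if i == 0 then D11 u else D22 u) else D12 u.

Definition lap u : gridfun R := fun l m => D11 u l m + D22 u l m.

Definition bilap u : gridfun R := fun l m =>
  D11 (D11 u) l m + 2 * D11 (D22 u) l m + D22 (D22 u) l m.

(* The cell functions below are indexed by the lower-left node of the cell. *)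
Definition cell_D1D1 u v : gridfun R := fun l m =>
  ((u (l + 1) m - u l m) * (v (l + 1) m - v l m)
   + (u (l + 1) (m + 1) - u l (m + 1)) * (v (l + 1) (m + 1) - v l (m + 1)))
  / (2 * h ^+ 2).

Definition cell_D2D2 u v : gridfun R := fun l m =>
  ((u l (m + 1) - u l m) * (v l (m + 1) - v l m)
   + (u (l + 1) (m + 1) - u (l + 1) m) * (v (l + 1) (m + 1) - v (l + 1) m))
  / (2 * h ^+ 2).

Definition cell_D1D2 u v : gridfun R := fun l m =>
  (u (l + 1) (m + 1) + u (l + 1) m - u l (m + 1) - u l m)
  * (v (l + 1) (m + 1) - v (l + 1) m + v l (m + 1) - v l m)
  / (4 * h ^+ 2).

Definition cell_avg u : gridfun R := fun l m =>
  (u l m + u (l + 1) m + u l (m + 1) + u (l + 1) (m + 1)) / 4.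

Definition cell_prod (i j : 'I_2) u v : gridfun R :=
  if i == j then (if i == 0 then cell_D1D1 u v else cell_D2D2 u v)
  else (if i == 0 then cell_D1D2 u v else cell_D1D2 v u).

(* Outward normal differences; [Dnx] is meant for l = 0 or l = N only, [Dny]
   for m = 0 or m = N only. *)
Variable N : nat.

Definition Dnx u : gridfun R := fun l m =>
  if l == 0 then (u (-1) m - u 1 m) / (2 * h)
  else (u (N%:Z + 1) m - u (N%:Z - 1) m) / (2 * h).

Definition Dny u : gridfun R := fun l m =>
  if m == 0 then (u l (-1) - u l 1) / (2 * h)
  else (u l (N%:Z + 1) - u l (N%:Z - 1)) / (2 * h).

End Differences.

Section Scheme.
Variables (R : realType) (k : coeffs R) (N : nat) (h : R).
Implicit Types (c : gridfun R) (Q : gridfun 'M[R]_2).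

Definition Lc c Q : gridfun R := fun l m =>
  2 * gamma k * c l m
  - 2 * c20 k * (\sum_(a < 2) DD h a a c l m)
  - c23 k * (\sum_(i < 2) \sum_(j < 2) DD h i j (comp Q i j) l m)
  + 2 * c40 k * bilap h c l m.

Definition LQ c Q (i j : 'I_2) : gridfun R := fun l m =>
  - 2 * c21 k * (\sum_(a < 2) DD h a a (comp Q i j) l m)
  - 2 * c22 k * (\sum_(a < 2) DD h i a (comp Q a j) l m)
  - c23 k * DD h i j c l m.

Definition Eplus c Q : R :=
  h ^+ 2 * sumCell N (fun l m =>
      c20 k * (\sum_(i < 2) cell_prod h i i c c l m)
    + c21 k * (\sum_(i < 2) \sum_(j < 2) \sum_(a < 2)
                 cell_prod h i i (comp Q j a) (comp Q j a) l m)
    + c22 k * (\sum_(i < 2) \sum_(j < 2) \sum_(a < 2)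
                 cell_prod h i a (comp Q i j) (comp Q a j) l m)
    + c23 k * (\sum_(i < 2) \sum_(j < 2)
                 cell_prod h j i c (comp Q i j) l m)
    + c40 k * cell_avg (fun l' m' => lap h c l' m' ^+ 2) l m)
  + h ^+ 2 * sumP N (fun l m => gamma k * c l m ^+ 2).

Definition Eminus c Q : R :=
  h ^+ 2 * sumP N (fun l m =>
    - (c00 k - gamma k) * c l m ^+ 2
    - c02 k * \sum_(i < 2) \sum_(j < 2) Q l m i j * Q l m i j).

(* [A] is the additive constant of the energy, cf. [boundary_determined]. *)
Definition Ehat (A : gridfun R -> gridfun 'M[R]_2 -> R) c Q : R :=
  h ^+ 2 * sumP N (fun l m => Xi k (c l m) (Q l m))
  + Eplus c Q - Eminus c Q + A c Q.

Definition eq_on_bnodes c Q c' Q' : Prop :=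
  forall l m, bnode N l m -> c l m = c' l m /\ Q l m = Q' l m.

Definition boundary_determined (A : gridfun R -> gridfun 'M[R]_2 -> R) : Prop :=
  forall c Q c' Q', eq_on_bnodes c Q c' Q' -> A c Q = A c' Q'.

Definition physical_inside c Q : Prop :=
  forall l m, interior N l m -> physical k (c l m) (Q l m).

(* [c1], [Q1] is a new time level obtained from [c0], [Q0] with time step
   [dt] and boundary-node values [cb], [Qb]. *)
Definition scheme (dt : R) (cb : gridfun R) (Qb : gridfun 'M[R]_2)
    c0 Q0 c1 Q1 : Prop :=
  [/\ physical_inside c1 Q1,
      forall l m, interior N l m ->
        (c1 l m - c0 l m) / dt =
        - Ghat N (fun l' m' => dXi_dc k (c1 l' m') (Q1 l' m')
                    + 2 * (c00 k - gamma k) * c0 l' m' + Lc c1 Q1 l' m') l m,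
      forall l m, interior N l m -> forall i j : 'I_2,
        (Q1 l m i j - Q0 l m i j) / dt =
        - symtl (\matrix_(a, b) (dXi_dQ k (c1 l m) (Q1 l m) a b
                    + 2 * c02 k * Q0 l m a b + LQ c1 Q1 a b l m)) i j,
      (forall l m, is_node N l m -> l = 0 \/ l = N%:Z ->
         (Dnx h N c1 l m - Dnx h N c0 l m) / dt = - lap h c1 l m) /\
      (forall l m, is_node N l m -> m = 0 \/ m = N%:Z ->
         (Dny h N c1 l m - Dny h N c0 l m) / dt = - lap h c1 l m) &
      eq_on_bnodes c1 Q1 cb Qb].

(* Equality of the triples (c, Q, D_n c): nodes, and normal derivatives on
   the boundary. *)
Definition same_data c Q c' Q' : Prop :=
  [/\ forall l m, is_node N l m -> c l m = c' l m /\ Q l m = Q' l m,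
      forall l m, is_node N l m -> l = 0 \/ l = N%:Z ->
        Dnx h N c l m = Dnx h N c' l m &
      forall l m, is_node N l m -> m = 0 \/ m = N%:Z ->
        Dny h N c l m = Dny h N c' l m].

Definition energy_law (dt : R) A c0 Q0 c1 Q1 : Prop :=
  Ehat A c1 Q1
  + h ^+ 2 *
      ((1 - (c00 k - gamma k) * dt) / dt
         * sumP N (fun l m => (c1 l m - c0 l m) ^+ 2)
       + (1 - c02 k * dt) / dt
         * sumP N (fun l m => \sum_(i < 2) \sum_(j < 2)
                                 (Q1 l m i j - Q0 l m i j) ^+ 2))
  + Eplus (gsub c1 c0) (gsub Q1 Q0)
  + 2 * c40 k * (h / dt)
      * sumEdge N (fun l m => (Dnx h N c1 l m - Dnx h N c0 l m) ^+ 2)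
                  (fun l m => (Dny h N c1 l m - Dny h N c0 l m) ^+ 2)
  <= Ehat A c0 Q0.

End Scheme.

(* Main.v *)
(* With the ghost values eliminated, one time step is the stationarity condition
   of a convex functional. Summation by parts on the grid expresses the first
   variation of the elastic energy through L_c, L_Q and the boundary sum of
   (lap c) (D_n d), which the boundary equation turns into a quadratic form; the
   elastic energy is nonnegative on differences vanishing at the boundary nodes
   (complete the square in div Q + c23 / (2 c22) grad c, then use the lower bound
   on gamma), and the quasi-entropy satisfies the gradient inequality by
   ln y <= y - 1. The energy law is the gradient inequality tested with the
   increment, and uniqueness is monotonicity of the gradient.
   For existence the functional is minimised over a compact convex set of states
   at distance eta from the boundary of the physical set. At the minimiser the
   slope towards the previous time step is nonnegative, so monotonicity against
   nearby states bounds the gradient of the quasi-entropy independently of eta.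
   As this gradient blows up at the boundary, for small eta the constraints are
   inactive and the minimiser solves the scheme. *)
From HB Require Import structures.
From mathcomp Require Import all_boot all_order all_algebra.
From mathcomp Require Import boolp classical_sets functions.
From mathcomp Require Import reals topology normedtype sequences derive exp.
From mathcomp Require Import ring lra zify.
(* Last, because [comp] and [interior] also exist in MathComp. *)
Require Import Defs.
Set Implicit Arguments.
Unset Strict Implicit.
Unset Printing Implicit Defensive.
Import Order.TTheory GRing.Theory Num.Theory numFieldNormedType.Exports.
Local Open Scope ring_scope.

(** * Summation by parts on the grid *)

(** Two obstacles shape the proof. The normal differences are unknowns of their own, with an
    equation that is not of the interior type. Given the nodal values, that equation fixes the ghost
    values through one scalar equation per boundary node, so only interior values remain free.
    Nothing is lost by this restriction: the functional carries an edge penalty of weight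
    [c40 h / dt], chosen so that at a state obeying the boundary equation its variation cancels the
    boundary sum left by summation by parts, whatever the ghost values of the competitor. The second
    obstacle is that the functional stays bounded as c tends to 0 or to M: an energy bound does not
    keep minimisers inside the open physical set, where alone the equations make sense. Hence the
    estimate on the gradient rather than on the energy. It works because in the coordinates c, Q_11,
    Q_12 the physical set is a truncated circular cone, convex and bounded, so a monotone gradient
    can be probed from fixed interior points. *)

Section LineSums.
Variable R : realType.
Implicit Types (f g w v : int -> R).

Lemma line_sum_lower (N : nat) w :
  w 0 = 0 -> \sum_(0 <= l < N) w l%:Z = \sum_(1 <= l < N) w l%:Z.
Proof.
move=> w0; case: N => [|N]; first by rewrite !big_geq.
by rewrite big_ltn // w0 add0r.
Qed.

Lemma line_sum_upper (N : nat) w :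
  w N%:Z = 0 -> \sum_(0 <= l < N) w (l%:Z + 1) = \sum_(1 <= l < N) w l%:Z.
Proof.
case: N => [|N] wN; first by rewrite !big_geq.
rewrite big_add1 /= big_nat_recr //= -PoszD addn1 wN addr0.
by apply: eq_big_nat => l _; rewrite -PoszD addn1.
Qed.

Lemma line_sum_telescope_down (N : nat) w : (0 < N)%N ->
  \sum_(1 <= l < N) w (l%:Z - 1)
  = \sum_(1 <= l < N) w l%:Z + w 0 - w (N%:Z - 1).
Proof.
case: N => // N _; elim: N => [|N IH]; first by rewrite !big_geq //= subrr; ring.
rewrite !(big_nat_recr N.+1) //= IH.
have -> : (N.+2%:Z - 1) = N.+1%:Z :> int by lia.
by ring.
Qed.

Lemma line_sum_telescope_up (N : nat) w : (0 < N)%N ->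
  \sum_(1 <= l < N) w (l%:Z + 1)
  = \sum_(1 <= l < N) w l%:Z + w N%:Z - w 1.
Proof.
case: N => // N _; elim: N => [|N IH]; first by rewrite !big_geq //=; ring.
rewrite !(big_nat_recr N.+1) //= IH.
have -> : (N.+1%:Z + 1) = N.+2%:Z :> int by lia.
by ring.
Qed.

(** The trapezoidal rule on a grid line: end nodes get half weight. Sums of cell averages are its
    tensor square, sums over boundary edges its one-dimensional instances. *)
Definition trap (N : nat) f : R := \sum_(0 <= l < N) (f l%:Z + f (l%:Z + 1)) / 2.

Lemma eq_trap (N : nat) f g :
  (forall l : int, 0 <= l <= N%:Z -> f l = g l) -> trap N f = trap N g.
Proof.
move=> fg; apply: eq_big_nat => l lN.
by rewrite !fg //; lia.
Qed.

Lemma trapD (N : nat) f g : trap N (fun l => f l + g l) = trap N f + trap N g.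
Proof. by rewrite /trap -big_split /=; apply: eq_bigr => l _; field. Qed.

Lemma trapZ (N : nat) (a : R) f : trap N (fun l => a * f l) = a * trap N f.
Proof. by rewrite /trap mulr_sumr; apply: eq_bigr => l _; field. Qed.

Lemma trap_sum (N a b : nat) (f : int -> int -> R) :
  trap N (fun m => \sum_(a <= l < b) f l%:Z m)
  = \sum_(a <= l < b) trap N (fun m => f l%:Z m).
Proof.
rewrite /trap exchange_big /=; apply: eq_bigr => m _.
by rewrite -big_split /= mulr_suml.
Qed.

Lemma trapE (N : nat) f : (0 < N)%N ->
  trap N f = \sum_(1 <= l < N) f l%:Z + (f 0 + f N%:Z) / 2.
Proof.
case: N => // N _; rewrite /trap; elim: N => [|N IH].
  by rewrite big_nat1 big_geq //= !add0r.
rewrite big_nat_recr //= IH [in RHS]big_nat_recr //=.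
have -> : (N.+1%:Z + 1) = N.+2%:Z :> int by lia.
by field.
Qed.

Lemma trap_ge (N : nat) f : (forall l, 0 <= f l) ->
  \sum_(1 <= l < N) f l%:Z <= trap N f.
Proof.
case: N => [|N] f0; first by rewrite /trap !big_geq.
by rewrite trapE // lerDl divr_ge0 ?addr_ge0.
Qed.

(** At the left end the rule contributes [g 0 (v (-1) + v 1) / 2], and moving the second difference
    onto [g] costs [g 0 * v 1]. The half weight is what makes the two combine into a centred normal
    difference; the right end is symmetric. *)
Lemma trap_byparts (N : nat) g v : (0 < N)%N -> v 0 = 0 -> v N%:Z = 0 ->
  trap N (fun l => g l * (v (l - 1) - 2 * v l + v (l + 1)))
  = \sum_(1 <= l < N) (g (l%:Z - 1) - 2 * g l%:Z + g (l%:Z + 1)) * v l%:Z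
    + (g 0 * (v (-1) - v 1) + g N%:Z * (v (N%:Z + 1) - v (N%:Z - 1))) / 2.
Proof.
move=> N0 v0 vN; rewrite trapE // v0 vN.
have E1 := line_sum_telescope_down (fun l => g (l + 1) * v l) N0.
have E2 := line_sum_telescope_up (fun l => g (l - 1) * v l) N0.
rewrite /= v0 vN in E1 E2.
transitivity (\sum_(1 <= l < N) g (l%:Z - 1 + 1) * v (l%:Z - 1)
  + \sum_(1 <= l < N) g (l%:Z + 1 - 1) * v (l%:Z + 1)
  - 2 * \sum_(1 <= l < N) g l%:Z * v l%:Z
  + (g 0 * (v (-1) + v 1) + g N%:Z * (v (N%:Z - 1) + v (N%:Z + 1))) / 2).
  congr (_ + _); last by rewrite !add0r; field.
  rewrite mulr_sumr -big_split /= -sumrB; apply: eq_bigr => l _.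
  by rewrite subrK addrK; ring.
rewrite E1 E2 subrK subrr.
have -> : \sum_(1 <= l < N) (g (l%:Z - 1) - 2 * g l%:Z + g (l%:Z + 1)) * v l%:Z
  = \sum_(1 <= l < N) g (l%:Z + 1) * v l%:Z
    + \sum_(1 <= l < N) g (l%:Z - 1) * v l%:Z
    - 2 * \sum_(1 <= l < N) g l%:Z * v l%:Z.
  by rewrite mulr_sumr -big_split /= -sumrB; apply: eq_bigr => l _; ring.
by field.
Qed.

End LineSums.

(** * Sums over interior nodes, cells and boundary edges *)

Section GridSums.
Variables (R : realType) (N : nat).
Implicit Types (u v f g : gridfun R).

Lemma interior_nat (l m : nat) :
  interior N l m = (1 <= l < N)%N && (1 <= m < N)%N.
Proof. by rewrite /interior; lia. Qed.

Lemma eq_sumP f g :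
  (forall l m, interior N l m -> f l m = g l m) -> sumP N f = sumP N g.
Proof.
move=> fg; apply: eq_big_nat => l lN; apply: eq_big_nat => m mN.
by apply: fg; rewrite interior_nat lN mN.
Qed.

Lemma sumPD f g : sumP N (fun l m => f l m + g l m) = sumP N f + sumP N g.
Proof. by rewrite /sumP -big_split; apply: eq_bigr => l _; rewrite -big_split. Qed.

Lemma sumPZ (a : R) f : sumP N (fun l m => a * f l m) = a * sumP N f.
Proof. by rewrite /sumP mulr_sumr; apply: eq_bigr => l _; rewrite mulr_sumr. Qed.

Lemma sumPN f : sumP N (fun l m => - f l m) = - sumP N f.
Proof. by rewrite /sumP -sumrN; apply: eq_bigr => l _; rewrite sumrN. Qed.

Lemma sumPB f g : sumP N (fun l m => f l m - g l m) = sumP N f - sumP N g.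
Proof. by rewrite -sumPN -sumPD. Qed.

Lemma ler_sumP f g :
  (forall l m, interior N l m -> f l m <= g l m) -> sumP N f <= sumP N g.
Proof.
move=> fg; apply: ler_sum_nat => l lN; apply: ler_sum_nat => m mN.
by apply: fg; rewrite interior_nat lN mN.
Qed.

Lemma sumP0 : sumP N (fun _ _ => 0 : R) = 0.
Proof. by rewrite /sumP big1 // => l _; rewrite big1. Qed.

Lemma sumP_ge0 f : (forall l m, interior N l m -> 0 <= f l m) -> 0 <= sumP N f.
Proof. by move=> f0; rewrite -sumP0; exact: ler_sumP. Qed.

Lemma eq_sumCell f g :
  (forall l m, 0 <= l < N%:Z -> 0 <= m < N%:Z -> f l m = g l m) ->
  sumCell N f = sumCell N g.
Proof.
move=> fg; apply: eq_big_nat => l lN; apply: eq_big_nat => m mN.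
by apply: fg; lia.
Qed.

Lemma sumCellD f g :
  sumCell N (fun l m => f l m + g l m) = sumCell N f + sumCell N g.
Proof. by rewrite /sumCell -big_split; apply: eq_bigr => l _; rewrite -big_split. Qed.

Lemma sumCellZ (a : R) f : sumCell N (fun l m => a * f l m) = a * sumCell N f.
Proof. by rewrite /sumCell mulr_sumr; apply: eq_bigr => l _; rewrite mulr_sumr. Qed.

Lemma ler_sumCell f g :
  (forall l m, f l m <= g l m) -> sumCell N f <= sumCell N g.
Proof. by move=> fg; apply: ler_sum => l _; apply: ler_sum. Qed.

(** Ghost values are left free, so the normal differences of such a field need not be zero. *)
Definition vanishes v := forall l m, bnode N l m -> v l m = 0.

Lemma vanishes_left v m : vanishes v -> 0 <= m <= N%:Z -> v 0 m = 0.
Proof. by move=> v0 mN; apply: v0; rewrite /bnode /is_node /interior; lia. Qed.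

Lemma vanishes_right v m : vanishes v -> 0 <= m <= N%:Z -> v N%:Z m = 0.
Proof. by move=> v0 mN; apply: v0; rewrite /bnode /is_node /interior; lia. Qed.

Lemma vanishes_bottom v l : vanishes v -> 0 <= l <= N%:Z -> v l 0 = 0.
Proof. by move=> v0 lN; apply: v0; rewrite /bnode /is_node /interior; lia. Qed.

Lemma vanishes_top v l : vanishes v -> 0 <= l <= N%:Z -> v l N%:Z = 0.
Proof. by move=> v0 lN; apply: v0; rewrite /bnode /is_node /interior; lia. Qed.

Lemma vanishesM f v : vanishes v -> vanishes (fun l m => f l m * v l m).
Proof. by move=> v0 l m /v0 ->; rewrite mulr0. Qed.

(** Running over the cells meets every interior node exactly once in each of the four corner
    positions, and the boundary nodes contribute nothing. *)
Lemma sumCell_corners f1 f2 f3 f4 :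
  vanishes f1 -> vanishes f2 -> vanishes f3 -> vanishes f4 ->
  sumCell N (fun l m => f1 l m + f2 (l + 1) m + f3 l (m + 1) + f4 (l + 1) (m + 1))
  = sumP N (fun l m => f1 l m + f2 l m + f3 l m + f4 l m).
Proof.
move=> v1 v2 v3 v4; rewrite !sumCellD !sumPD; congr (_ + _ + _ + _).
- rewrite /sumCell (line_sum_lower N (w := fun l => \sum_(0 <= m < N) f1 l m%:Z)).
    apply: eq_big_nat => l lN; rewrite (line_sum_lower N (w := f1 l)) //.
    by apply: vanishes_bottom => //; lia.
  by rewrite big_nat big1 // => m mN; apply: vanishes_left => //; lia.
- rewrite /sumCell (line_sum_upper (w := fun l => \sum_(0 <= m < N) f2 l m%:Z)).
    apply: eq_big_nat => l lN; rewrite (line_sum_lower N (w := f2 l)) //.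
    by apply: vanishes_bottom => //; lia.
  by rewrite big_nat big1 // => m mN; apply: vanishes_right => //; lia.
- rewrite /sumCell (line_sum_lower N (w := fun l => \sum_(0 <= m < N) f3 l (m%:Z + 1))).
    apply: eq_big_nat => l lN; rewrite (line_sum_upper (w := f3 l)) //.
    by apply: vanishes_top => //; lia.
  by rewrite big_nat big1 // => m mN; apply: vanishes_left => //; lia.
- rewrite /sumCell (line_sum_upper (w := fun l => \sum_(0 <= m < N) f4 l (m%:Z + 1))).
    apply: eq_big_nat => l lN; rewrite (line_sum_upper (w := f4 l)) //.
    by apply: vanishes_top => //; lia.
  by rewrite big_nat big1 // => m mN; apply: vanishes_right => //; lia.
Qed.

Lemma sumCell_avg f : sumCell N (cell_avg f) = trap N (fun l => trap N (f l)).
Proof.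
rewrite /sumCell /trap; apply: eq_bigr => l _.
rewrite -big_split mulr_suml; apply: eq_bigr => m _ /=.
by rewrite /cell_avg; field.
Qed.

Lemma sumCell_avg_ge f : (forall l m, 0 <= f l m) ->
  sumP N f <= sumCell N (cell_avg f).
Proof.
move=> f0; rewrite sumCell_avg.
apply: le_trans (trap_ge (f := fun l => trap N (f l)) _ _).
  by apply: ler_sum => l _; apply: trap_ge.
move=> l; apply: le_trans (trap_ge (f := f l) _ (f0 l)).
by apply: sumr_ge0.
Qed.

Lemma sumEdgeE (fx fy : gridfun R) :
  sumEdge N fx fy = trap N (fun m => fx 0 m + fx N%:Z m)
                    + trap N (fun l => fy l 0 + fy l N%:Z).
Proof. by congr (_ + _); apply: eq_bigr => l _; field. Qed.

Lemma sumEdge_ge0 (fx fy : gridfun R) :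
  (forall l m, 0 <= fx l m) -> (forall l m, 0 <= fy l m) ->
  0 <= sumEdge N fx fy.
Proof.
by move=> fx0 fy0; apply: addr_ge0; apply: sumr_ge0 => i _;
  rewrite addr_ge0 // divr_ge0 // addr_ge0.
Qed.

End GridSums.

(** * Summation by parts for second differences and the bilaplacian *)

Section ByParts.
Variables (R : realType) (N : nat) (h : R).
Hypotheses (N0 : (0 < N)%N) (h0 : h != 0).
Implicit Types (u v : gridfun R).

Lemma byparts_D11 u v : vanishes N v ->
  sumCell N (cell_D1D1 h u v) = - sumP N (fun l m => D11 h u l m * v l m).
Proof.
move=> v0.
(* The coefficients of [v] at the left corners ([a]) and at the right corners ([b]) of a cell,
   re-indexed by the corner itself. *)
pose a l m := - (u (l + 1) m - u l m) / (2 * h ^+ 2).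
pose b l m := (u l m - u (l - 1) m) / (2 * h ^+ 2).
have := sumCell_corners (vanishesM a v0) (vanishesM b v0) (vanishesM a v0)
  (vanishesM b v0).
rewrite /a /b => E; rewrite -sumPN; etransitivity; last first.
  etransitivity; first exact: E.
  by apply: eq_sumP => l m _; rewrite /D11; field.
by apply: eq_sumCell => l m _ _; rewrite /cell_D1D1 !addrK; field.
Qed.

Lemma byparts_D22 u v : vanishes N v ->
  sumCell N (cell_D2D2 h u v) = - sumP N (fun l m => D22 h u l m * v l m).
Proof.
move=> v0.
pose a l m := - (u l (m + 1) - u l m) / (2 * h ^+ 2).
pose b l m := (u l m - u l (m - 1)) / (2 * h ^+ 2).
have := sumCell_corners (vanishesM a v0) (vanishesM a v0) (vanishesM b v0)
  (vanishesM b v0).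
rewrite /a /b => E; rewrite -sumPN; etransitivity; last first.
  etransitivity; first exact: E.
  by apply: eq_sumP => l m _; rewrite /D22; field.
by apply: eq_sumCell => l m _ _; rewrite /cell_D2D2 !addrK; field.
Qed.

Let cross (l m : int) u := u (l + 1) (m + 1) + u (l + 1) m - u l (m + 1) - u l m.

Lemma byparts_D12 u v : vanishes N v ->
  sumCell N (cell_D1D2 h u v) = - sumP N (fun l m => D12 h u l m * v l m).
Proof.
move=> v0.
pose a l m := - cross l m u / (4 * h ^+ 2).
pose b l m := - cross (l - 1) m u / (4 * h ^+ 2).
pose c l m := cross l (m - 1) u / (4 * h ^+ 2).
pose d l m := cross (l - 1) (m - 1) u / (4 * h ^+ 2).
have := sumCell_corners (vanishesM a v0) (vanishesM b v0) (vanishesM c v0)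
  (vanishesM d v0).
rewrite /a /b /c /d /cross => E; rewrite -sumPN; etransitivity; last first.
  etransitivity; first exact: E.
  by apply: eq_sumP => l m _; rewrite /D12 !subrK; field.
by apply: eq_sumCell => l m _ _; rewrite /cell_D1D2 !addrK; field.
Qed.

(** The two orders of the mixed product differ on a single cell, but collecting the coefficients of
    [v] around a node telescopes to the same symmetric stencil. *)
Lemma byparts_D21 u v : vanishes N v ->
  sumCell N (cell_D1D2 h v u) = - sumP N (fun l m => D12 h u l m * v l m).
Proof.
move=> v0.
pose cr (l m : int) := u (l + 1) (m + 1) - u (l + 1) m + u l (m + 1) - u l m.
pose a l m := - cr l m / (4 * h ^+ 2).
pose b l m := cr (l - 1) m / (4 * h ^+ 2).
pose c l m := - cr l (m - 1) / (4 * h ^+ 2).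
pose d l m := cr (l - 1) (m - 1) / (4 * h ^+ 2).
have := sumCell_corners (vanishesM a v0) (vanishesM b v0) (vanishesM c v0)
  (vanishesM d v0).
rewrite /a /b /c /d /cr => E; rewrite -sumPN; etransitivity; last first.
  etransitivity; first exact: E.
  by apply: eq_sumP => l m _; rewrite /D12 !subrK; field.
by apply: eq_sumCell => l m _ _; rewrite /cell_D1D2 !addrK; field.
Qed.

Lemma byparts_DD i j u v : vanishes N v ->
  sumCell N (cell_prod h i j u v) = - sumP N (fun l m => DD h i j u l m * v l m).
Proof.
move=> v0; rewrite /cell_prod /DD; case: eqP => _; case: eqP => _.
- exact: byparts_D11.
- exact: byparts_D22.
- exact: byparts_D12.
- exact: byparts_D21.
Qed.

(** [trap_byparts] is applied along the grid lines of each direction. In the bulk terms the outer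
    lines drop out because [v] vanishes there, but on these lines the normal differences still see
    ghost values: a corner thus enters through both of its sides. *)
Lemma byparts_lap u v : vanishes N v ->
  sumCell N (cell_avg (fun l m => lap h u l m * lap h v l m))
  = sumP N (fun l m => bilap h u l m * v l m)
    + sumEdge N (fun l m => lap h u l m * Dnx h N v l m)
                (fun l m => lap h u l m * Dny h N v l m) / h.
Proof.
move=> v0; rewrite sumCell_avg.
set W := lap h u.
pose X l m := W l m * (v (l - 1) m - 2 * v l m + v (l + 1) m).
pose Y l m := W l m * (v l (m - 1) - 2 * v l m + v l (m + 1)).
have split_lap : trap N (fun l => trap N (fun m => W l m * lap h v l m))
    = (trap N (fun m => trap N (X ^~ m)) + trap N (fun l => trap N (Y l))) / h ^+ 2.
  transitivity (trap N (fun l => h ^- 2 * trap N (X l))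
                + trap N (fun l => h ^- 2 * trap N (Y l))).
    rewrite -trapD; apply: eq_trap => l _.
    rewrite -!trapZ -trapD; apply: eq_trap => m _.
    by rewrite /lap /D11 /D22 /X /Y; field.
  rewrite !trapZ mulrDl !(mulrC _ (h ^- 2)); congr (_ * _ + _).
  (* Fubini for the double trapezoidal sum, so that the x-part can be summed along horizontal
     lines. *)
  by rewrite -!sumCell_avg /sumCell exchange_big /=; apply: eq_bigr => l _;
     apply: eq_bigr => m _; rewrite /cell_avg; field.
rewrite split_lap.
have -> : trap N (fun m => trap N (X ^~ m))
  = h ^+ 2 * sumP N (fun l m => D11 h W l m * v l m)
    + h * trap N (fun m => W 0 m * Dnx h N v 0 m + W N%:Z m * Dnx h N v N%:Z m).
  transitivity (trap N (fun m =>
      \sum_(1 <= l < N) h ^+ 2 * (D11 h W l%:Z m * v l%:Z m)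
      + h * (W 0 m * Dnx h N v 0 m + W N%:Z m * Dnx h N v N%:Z m))).
    apply: eq_trap => m mN.
    rewrite (trap_byparts (W ^~ m) (v := v ^~ m)) //; last 2 first.
    - exact: vanishes_left v0 mN.
    - exact: vanishes_right v0 mN.
    congr (_ + _).
      by apply: eq_bigr => l _; rewrite /D11; field.
    rewrite /Dnx eqxx; have -> : (N%:Z == 0) = false by lia.
    by field.
  rewrite trapD trapZ; congr (_ + _).
  rewrite (trap_sum N 1 N (fun l m => h ^+ 2 * (D11 h W l m * v l m))).
  rewrite -sumPZ /sumP; apply: eq_big_nat => l lN.
  rewrite trapE // (vanishes_bottom v0) ?(vanishes_top v0); try lia.
  by rewrite !mulr0 addr0 mul0r addr0.
have -> : trap N (fun l => trap N (Y l))
  = h ^+ 2 * sumP N (fun l m => D22 h W l m * v l m)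
    + h * trap N (fun l => W l 0 * Dny h N v l 0 + W l N%:Z * Dny h N v l N%:Z).
  transitivity (trap N (fun l =>
      \sum_(1 <= m < N) h ^+ 2 * (D22 h W l m%:Z * v l m%:Z)
      + h * (W l 0 * Dny h N v l 0 + W l N%:Z * Dny h N v l N%:Z))).
    apply: eq_trap => l lN.
    rewrite (trap_byparts (W l) (v := v l)) //; last 2 first.
    - exact: vanishes_bottom v0 lN.
    - exact: vanishes_top v0 lN.
    congr (_ + _).
      by apply: eq_bigr => m _; rewrite /D22; field.
    rewrite /Dny eqxx; have -> : (N%:Z == 0) = false by lia.
    by field.
  rewrite trapD trapZ; congr (_ + _).
  rewrite (trap_sum N 1 N (fun m l => h ^+ 2 * (D22 h W l m * v l m))).
  rewrite -sumPZ /sumP [RHS]exchange_big /=; apply: eq_big_nat => m mN.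
  rewrite trapE // (vanishes_left v0) ?(vanishes_right v0); try lia.
  by rewrite !mulr0 addr0 mul0r addr0.
have -> : sumP N (fun l m => bilap h u l m * v l m)
  = sumP N (fun l m => D11 h W l m * v l m) + sumP N (fun l m => D22 h W l m * v l m).
  rewrite -sumPD; apply: eq_sumP => l m _.
  by rewrite /bilap /W /lap /D11 /D22; field.
by rewrite sumEdgeE; field.
Qed.

End ByParts.
Lemma sum_ord2 (V : nmodType) (F : 'I_2 -> V) : \sum_(i < 2) F i = F 0 + F 1.
Proof.
by rewrite !big_ord_recl big_ord0 addr0; congr (F _ + F _); apply: val_inj.
Qed.

Lemma ord2P (i : 'I_2) : i = 0 \/ i = 1.
Proof.
by case: i => [[|[|//]] ?]; [left | right]; apply: val_inj.
Qed.

(** * The elastic energy *)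

Section ElasticEnergy.
Variables (R : realType) (k : coeffs R) (N : nat) (h : R).
Implicit Types (c d u v w : gridfun R) (Q D : gridfun 'M[R]_2).

Lemma cell_prodC (i j : 'I_2) u v : cell_prod h i j u v =2 cell_prod h j i v u.
Proof.
move=> l m; case: (ord2P i) (ord2P j) => -> [] -> //;
  by rewrite /cell_prod /= /cell_D1D1 /cell_D2D2; congr (_ / _); ring.
Qed.

Lemma DDC (i j : 'I_2) u : DD h i j u = DD h j i u.
Proof. by case: (ord2P i) (ord2P j) => -> [] ->. Qed.

(** Bilinear expansion around [u], [v]. The third term is transposed so that the increment is always
    the second argument, the one that summation by parts frees from differences. *)
Lemma cell_prod_gsub (i j : 'I_2) u v u' v' l m :
  cell_prod h i j u' v' l m
  = cell_prod h i j u v l m + cell_prod h i j u (gsub v' v) l m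
    + cell_prod h j i v (gsub u' u) l m
    + cell_prod h i j (gsub u' u) (gsub v' v) l m.
Proof.
rewrite -(cell_prodC i j (gsub u' u) v).
by case: (ord2P i) (ord2P j) => -> [] ->;
  rewrite /cell_prod /= /cell_D1D1 /cell_D2D2 /cell_D1D2 /gsub; ring.
Qed.

Lemma lap_gsub u u' l m : lap h (gsub u' u) l m = lap h u' l m - lap h u l m.
Proof. by rewrite /lap /D11 /D22 /gsub; ring. Qed.

Lemma Dnx_gsub u u' l m : Dnx h N (gsub u' u) l m = Dnx h N u' l m - Dnx h N u l m.
Proof. by rewrite /Dnx /gsub; case: ifP => _; ring. Qed.

Lemma Dny_gsub u u' l m : Dny h N (gsub u' u) l m = Dny h N u' l m - Dny h N u l m.
Proof. by rewrite /Dny /gsub; case: ifP => _; ring. Qed.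

Lemma comp_gsub Q Q' i j : comp (gsub Q' Q) i j = gsub (comp Q' i j) (comp Q i j).
Proof. by apply/funext => l; apply/funext => m; rewrite /comp /gsub !mxE. Qed.

Definition pairing c Q d D : gridfun R := fun l m =>
  Lc k h c Q l m * d l m
  + \sum_(i < 2) \sum_(j < 2) LQ k h c Q i j l m * comp D i j l m.

Definition elastic_density c Q : gridfun R := fun l m =>
    c20 k * (\sum_(i < 2) cell_prod h i i c c l m)
  + c21 k * (\sum_(i < 2) \sum_(j < 2) \sum_(a < 2)
               cell_prod h i i (comp Q j a) (comp Q j a) l m)
  + c22 k * (\sum_(i < 2) \sum_(j < 2) \sum_(a < 2)
               cell_prod h i a (comp Q i j) (comp Q a j) l m)
  + c23 k * (\sum_(i < 2) \sum_(j < 2) cell_prod h j i c (comp Q i j) l m)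
  + c40 k * cell_avg (fun l' m' => lap h c l' m' ^+ 2) l m.

Lemma EplusE c Q : Eplus k N h c Q = h ^+ 2 * sumCell N (elastic_density c Q)
  + h ^+ 2 * sumP N (fun l m => gamma k * c l m ^+ 2).
Proof. by []. Qed.

Section Variation.
Hypotheses (N0 : (0 < N)%N) (h0 : h != 0).
Variables (c : gridfun R) (Q : gridfun 'M[R]_2).

Let P := cell_prod h.
(** [crossQ] and [crossc] are the linear part of the expansion, sorted by the scalar component of
    the increment, so that each group is summed by parts against a single vanishing field. *)
Let crossQ D i j l m :=
  2 * c21 k * (P 0 0 (comp Q i j) (comp D i j) l m
               + P 1 1 (comp Q i j) (comp D i j) l m)
  + 2 * c22 k * (P 0 i (comp Q 0 j) (comp D i j) l m
                 + P 1 i (comp Q 1 j) (comp D i j) l m)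
  + c23 k * P j i c (comp D i j) l m.

Let crossc d l m :=
  2 * c20 k * (P 0 0 c d l m + P 1 1 c d l m)
  + c23 k * (P 0 0 (comp Q 0 0) d l m + P 0 1 (comp Q 0 1) d l m
             + P 1 0 (comp Q 1 0) d l m + P 1 1 (comp Q 1 1) d l m)
  + 2 * c40 k * cell_avg (fun l m => lap h c l m * lap h d l m) l m.

Let sum_crossQ D i j : vanishes N (comp D i j) ->
  sumCell N (crossQ D i j) = sumP N (fun l m => LQ k h c Q i j l m * comp D i j l m).
Proof.
move=> v0; rewrite /crossQ /P !(sumCellD, sumCellZ) !byparts_DD //.
rewrite -!sumPN -!(sumPD, sumPZ); apply: eq_sumP => l m _.
by rewrite /LQ !sum_ord2 (DDC 0 i) (DDC 1 i) (DDC j i); ring.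
Qed.

Let sum_crossc d : vanishes N d ->
  sumCell N (crossc d)
  = sumP N (fun l m => (Lc k h c Q l m - 2 * gamma k * c l m) * d l m)
    + 2 * c40 k / h * sumEdge N (fun l m => lap h c l m * Dnx h N d l m)
                            (fun l m => lap h c l m * Dny h N d l m).
Proof.
move=> v0; rewrite /crossc /P !(sumCellD, sumCellZ) !byparts_DD // byparts_lap //.
rewrite (mulrDr (2 * c40 k)).
rewrite !addrA; congr (_ + _); last by field.
rewrite -!sumPN -!(sumPD, sumPZ); apply: eq_sumP => l m _.
by rewrite /Lc !sum_ord2; ring.
Qed.

(** An exact identity, since the energy is quadratic: the last term is the whole remainder. *)
Lemma Eplus_variation c' Q' : eq_on_bnodes N c' Q' c Q ->
  Eplus k N h c' Q' = Eplus k N h c Q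
    + h ^+ 2 * sumP N (pairing c Q (gsub c' c) (gsub Q' Q))
    + 2 * c40 k * h * sumEdge N (fun l m => lap h c l m * Dnx h N (gsub c' c) l m)
                                (fun l m => lap h c l m * Dny h N (gsub c' c) l m)
    + Eplus k N h (gsub c' c) (gsub Q' Q).
Proof.
move=> eqb; set d := gsub c' c; set D := gsub Q' Q.
have vd : vanishes N d by move=> l m /eqb [E _]; rewrite /d /gsub E subrr.
have vD i j : vanishes N (comp D i j).
  by move=> l m /eqb [_ E]; rewrite /comp /D /gsub E subrr mxE.
have E := sum_crossc vd.
have F i j := sum_crossQ (vD i j).
rewrite !EplusE; set e := elastic_density.
have cellE : sumCell N (e c' Q') = sumCell N (e c Q) + sumCell N (e d D)
  + sumCell N (crossc d) + (sumCell N (crossQ D 0 0) + sumCell N (crossQ D 0 1)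
    + sumCell N (crossQ D 1 0) + sumCell N (crossQ D 1 1)).
  rewrite -!sumCellD; apply: eq_sumCell => l m _ _.
  have GQ i j a b a' b' := cell_prod_gsub i j (comp Q a b) (comp Q a' b')
    (comp Q' a b) (comp Q' a' b') l m.
  have GcQ i j a b := cell_prod_gsub i j c (comp Q a b) c' (comp Q' a b) l m.
  have Gc i j := cell_prod_gsub i j c c c' c' l m.
  rewrite /e /elastic_density !sum_ord2 /crossc /crossQ /P /D !comp_gsub.
  rewrite !GQ !GcQ !Gc -!/d /cell_avg !lap_gsub.
  ring.
rewrite cellE E !F.
have gammaE : sumP N (fun l m => gamma k * c' l m ^+ 2)
  = sumP N (fun l m => gamma k * c l m ^+ 2)
    + sumP N (fun l m => 2 * gamma k * c l m * d l m)
    + sumP N (fun l m => gamma k * d l m ^+ 2).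
  by rewrite -!sumPD; apply: eq_sumP => l m _; rewrite /d /gsub; ring.
have pairE : sumP N (pairing c Q d D)
  = sumP N (fun l m => (Lc k h c Q l m - 2 * gamma k * c l m) * d l m)
    + sumP N (fun l m => 2 * gamma k * c l m * d l m)
    + (sumP N (fun l m => LQ k h c Q 0 0 l m * comp D 0 0 l m)
    + sumP N (fun l m => LQ k h c Q 0 1 l m * comp D 0 1 l m)
    + sumP N (fun l m => LQ k h c Q 1 0 l m * comp D 1 0 l m)
    + sumP N (fun l m => LQ k h c Q 1 1 l m * comp D 1 1 l m)).
  by rewrite -!sumPD; apply: eq_sumP => l m _; rewrite /pairing !sum_ord2; ring.
by rewrite gammaE pairE; field.
Qed.

End Variation.

Section Positivity.
Hypothesis h0 : h != 0.

(** The cell version of [(D_1 u + D_2 v)^2]. The mixed product sees only averages over opposite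
    edges, the pure products both edges, so the form is the square of the averaged divergence plus
    the squared differences between opposite edges. *)
Lemma cell_div_ge0 u v l m :
  0 <= cell_prod h 0 0 u u l m + 2 * cell_prod h 0 1 u v l m
       + cell_prod h 1 1 v v l m.
Proof.
pose a1 := u (l + 1) m - u l m; pose a2 := u (l + 1) (m + 1) - u l (m + 1).
pose b1 := v l (m + 1) - v l m; pose b2 := v (l + 1) (m + 1) - v (l + 1) m.
have -> : cell_prod h 0 0 u u l m + 2 * cell_prod h 0 1 u v l m
    + cell_prod h 1 1 v v l m
  = ((a1 + a2 + b1 + b2) ^+ 2 + (a1 - a2) ^+ 2 + (b1 - b2) ^+ 2) / (2 * h) ^+ 2.
  rewrite /cell_prod /= /cell_D1D1 /cell_D2D2 /cell_D1D2 /a1 /a2 /b1 /b2.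
  by field.
by rewrite divr_ge0 ?addr_ge0 ?sqr_ge0.
Qed.

Lemma cell_grad_ge0 i u l m : 0 <= cell_prod h i i u u l m.
Proof.
by case: (ord2P i) => ->; rewrite /cell_prod /= divr_ge0 ?addr_ge0 //
  -?expr2 ?sqr_ge0 // mulr_ge0 ?sqr_ge0.
Qed.

(* Completing the square in c22 |div Q + c23 / (2 c22) grad c|^2 leaves the
   coefficient c20 - c23^2 / (4 c22) in front of |grad c|^2. *)
Lemma elastic_density_ge c Q l m : 0 < c21 k -> 0 < c22 k ->
  Num.min (c20 k - c23 k ^+ 2 / (4 * c22 k)) 0
    * (cell_prod h 0 0 c c l m + cell_prod h 1 1 c c l m)
  + c40 k * cell_avg (fun l' m' => lap h c l' m' ^+ 2) l m
  <= elastic_density c Q l m.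
Proof.
move=> c21p c22p; rewrite lerD2r; set b := Num.min _ _.
have c22n : c22 k != 0 by rewrite gt_eqF.
pose s := c23 k / (2 * c22 k).
pose sh u : gridfun R := fun l m => u l m + s * c l m.
(* Component j of div Q is built from column j of [Q]. There [D_j c] is absorbed by shifting only
   the diagonal entry [Q_jj]: [E0] treats j = 0, [E1] treats j = 1. *)
have E0 u v : c22 k * (cell_prod h 0 0 u u l m + 2 * cell_prod h 0 1 u v l m
      + cell_prod h 1 1 v v l m)
    + c23 k * (cell_prod h 0 0 c u l m + cell_prod h 0 1 c v l m)
  = c22 k * (cell_prod h 0 0 (sh u) (sh u) l m + 2 * cell_prod h 0 1 (sh u) v l m
      + cell_prod h 1 1 v v l m)
    - c23 k ^+ 2 / (4 * c22 k) * cell_prod h 0 0 c c l m.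
  rewrite /cell_prod /= /cell_D1D1 /cell_D2D2 /cell_D1D2 /sh /s.
  by field; rewrite h0.
have E1 u v : c22 k * (cell_prod h 0 0 u u l m + 2 * cell_prod h 0 1 u v l m
      + cell_prod h 1 1 v v l m)
    + c23 k * (cell_prod h 1 0 c u l m + cell_prod h 1 1 c v l m)
  = c22 k * (cell_prod h 0 0 u u l m + 2 * cell_prod h 0 1 u (sh v) l m
      + cell_prod h 1 1 (sh v) (sh v) l m)
    - c23 k ^+ 2 / (4 * c22 k) * cell_prod h 1 1 c c l m.
  rewrite /cell_prod /= /cell_D1D1 /cell_D2D2 /cell_D1D2 /sh /s.
  by field; rewrite h0.
have F0 u v := mulr_ge0 (ltW c22p) (cell_div_ge0 u v l m).
have G i u := mulr_ge0 (ltW c21p) (cell_grad_ge0 i u l m).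
have bP i : b * cell_prod h i i c c l m
    <= (c20 k - c23 k ^+ 2 / (4 * c22 k)) * cell_prod h i i c c l m.
  by rewrite ler_wpM2r ?cell_grad_ge0 // ge_min lexx.
rewrite !sum_ord2 !(cell_prodC 1 0 (comp Q _ _) (comp Q _ _)).
have := E0 (comp Q 0 0) (comp Q 1 0); have := E1 (comp Q 0 1) (comp Q 1 1).
have := F0 (sh (comp Q 0 0)) (comp Q 1 0).
have := F0 (comp Q 0 1) (sh (comp Q 1 1)).
have := bP 0; have := bP 1.
have := G 0 (comp Q 0 0); have := G 0 (comp Q 0 1).
have := G 0 (comp Q 1 0); have := G 0 (comp Q 1 1).
have := G 1 (comp Q 0 0); have := G 1 (comp Q 0 1).
have := G 1 (comp Q 1 0); have := G 1 (comp Q 1 1).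
move: (c23 k ^+ 2 / _) => q *; lra.
Qed.

(** Since [d] vanishes at the boundary nodes, [|grad d|^2] sums to [- d (lap d)]. At each node there
    remains a quadratic form in [lap d] and [d], and the bound on [gamma] is its discriminant
    condition. Cell averages of [(lap d)^2] dominate the interior sum, which brings both terms to
    the same nodes. *)
Lemma Eplus_ge0 d D : admissible k -> vanishes N d -> 0 <= Eplus k N h d D.
Proof.
move=> [_ [c40p c21p c22p] _ _]; set b := Num.min _ _ => bg vd.
rewrite EplusE -mulrDr mulr_ge0 ?sqr_ge0 //.
apply: (@le_trans _ _ (sumP N (fun l m => - b * (lap h d l m * d l m)
    + c40 k * lap h d l m ^+ 2 + gamma k * d l m ^+ 2))).
  apply: sumP_ge0 => l m _; set x := lap h d l m; set y := d l m.
  have -> : - b * (x * y) + c40 k * x ^+ 2 + gamma k * y ^+ 2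
    = c40 k * (x - b / (2 * c40 k) * y) ^+ 2
      + (gamma k - b ^+ 2 / (4 * c40 k)) * y ^+ 2.
    by field; rewrite gt_eqF.
  by rewrite addr_ge0 // mulr_ge0 ?sqr_ge0 ?subr_ge0 // ltW.
rewrite sumPD lerD2r.
apply: le_trans (ler_sumCell N (fun l m => elastic_density_ge d D l m c21p c22p)).
rewrite sumCellD !sumCellZ sumCellD !byparts_DD // sumPD sumPZ lerD //.
  rewrite sumPZ -/b -opprD -sumPD mulrN -mulNr.
  rewrite (@eq_sumP _ _ _ (fun l m => DD h 0 0 d l m * d l m + DD h 1 1 d l m * d l m)) //.
  by move=> l m _; rewrite /lap mulrDl.
by rewrite ler_wpM2l ?sumCell_avg_ge // 1?ltW // => l m; rewrite sqr_ge0.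
Qed.

End Positivity.

End ElasticEnergy.

(** * The quasi-entropy *)

Section LocalPotential.
Variables (R : realType) (k : coeffs R).
Hypotheses (M0 : 0 < cmax k) (nu0 : 0 < nu k).

(** The general symmetric traceless matrix; its eigenvalues are plus and minus the square root of
    [a^2 + b^2]. *)
Definition qmat (a b : R) : 'M[R]_2 :=
  \matrix_(i, j) (if i == j then (if i == 0 then a else - a) else b).

Lemma det_mx22 (T : comPzRingType) (A : 'M[T]_2) :
  \det A = A 0 0 * A 1 1 - A 0 1 * A 1 0.
Proof.
rewrite (expand_det_row _ 0) sum_ord2 /cofactor !det_mx11 !mxE.
have -> : lift (0 : 'I_2) (0 : 'I_1) = 1 by exact: val_inj.
have -> : lift (1 : 'I_2) (0 : 'I_1) = 0 by exact: val_inj.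
by rewrite expr0 expr1 mul1r mulN1r mulrN.
Qed.

Lemma eigenvalue_qmat a b x : eigenvalue (qmat a b) x = (x ^+ 2 == a ^+ 2 + b ^+ 2).
Proof.
rewrite eigenvalue_root_char /char_poly det_mx22 !mxE /= rootE !hornerE /=.
by rewrite -[RHS]subr_eq0; congr (_ == _); ring.
Qed.

Lemma qmat_entries (Q : 'M[R]_2) : Q = Q^T -> \tr Q = 0 -> Q = qmat (Q 0 0) (Q 0 1).
Proof.
move=> /matrixP sQ; rewrite /mxtrace sum_ord2 => /eqP; rewrite addrC addr_eq0 => /eqP tQ.
apply/matrixP => i j; rewrite mxE.
case: (ord2P i) (ord2P j) => -> [] -> //=.
by rewrite (sQ 1 0) mxE.
Qed.

(** The physical set in the coordinates c, a, b: an open circular cone truncated at c = M. *)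
Definition in_cone (c a b : R) := 0 < c < cmax k /\ 4 * (a ^+ 2 + b ^+ 2) < c ^+ 2.

Lemma physicalE (c : R) (Q : 'M[R]_2) : physical k c Q <->
  Q = qmat (Q 0 0) (Q 0 1) /\ in_cone c (Q 0 0) (Q 0 1).
Proof.
split=> [[cM sQ tQ eQ]|[-> [cM rc]]].
  have QE := qmat_entries sQ tQ; split=> //; split=> //.
  set r2 := _ + _; have r20 : 0 <= r2 by rewrite addr_ge0 ?sqr_ge0.
  have := eQ (Num.sqrt r2); rewrite QE eigenvalue_qmat sqr_sqrtr // eqxx.
  move=> /(_ isT); have := sqr_sqrtr r20; have := sqrtr_ge0 r2.
  by case/andP: cM => *; nra.
split=> //.
- apply/matrixP => i j; rewrite !mxE eq_sym; case: eqP => // ->; by [].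
- by rewrite /mxtrace sum_ord2 !mxE /= subrr.
- move=> x; rewrite eigenvalue_qmat => /eqP x2.
  move: rc; rewrite !mxE /= => rc.
  by case/andP: cM => *; apply/andP; split; nra.
Qed.

(** Four times the determinant of Q/c + I/2, so that the quasi-entropy is [- ln (relgap c a b)]. *)
Definition relgap (c a b : R) := 1 - 4 * (a ^+ 2 + b ^+ 2) / c ^+ 2.

(** [grad_c], [grad_a] and [grad_b] are the partial derivatives of [Xi] composed with [qmat]. This
    is never proved by differentiation: they act only as the subgradient in [Xi_grad_ineq]. *)
Definition grad_c (c a b : R) :=
  ln (cmax k * c / (cmax k - c)) - nu k * ln (relgap c a b)
  - 8 * nu k * (a ^+ 2 + b ^+ 2) / (c ^+ 2 * relgap c a b).

Definition grad_a (c a b : R) := 8 * nu k * a / (c * relgap c a b).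

Definition grad_b (c a b : R) := 8 * nu k * b / (c * relgap c a b).

Lemma relgap_gt0 c a b : in_cone c a b -> 0 < relgap c a b.
Proof.
move=> [/andP[c0 _] rc].
by rewrite subr_gt0 ltr_pdivrMr ?exprn_gt0 // mul1r.
Qed.

Lemma relgap_le1 c a b : relgap c a b <= 1.
Proof.
by rewrite gerBl divr_ge0 ?sqr_ge0 // mulr_ge0 // addr_ge0 ?sqr_ge0.
Qed.

Lemma det_half_id : \det (half_id R) = 1 / 4.
Proof. by rewrite /half_id det_scalar; field. Qed.

Lemma qent_qmat c a b : in_cone c a b -> qent (c^-1 *: qmat a b) = - ln (relgap c a b).
Proof.
move=> cab; have g0 := relgap_gt0 cab; case: cab => /andP[c0 _] _.
rewrite /qent det_half_id.
have -> : \det (c^-1 *: qmat a b + half_id R) = relgap c a b / 4.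
  by rewrite det_mx22 /half_id !mxE /= /relgap; field; rewrite gt_eqF.
by rewrite !ln_div ?posrE ?divr_gt0 //; rewrite ln1; ring.
Qed.

Lemma Xi_qmat c a b : in_cone c a b -> Xi k c (qmat a b)
  = c * ln c + (cmax k - c) * ln (1 - c / cmax k) - c * nu k * ln (relgap c a b).
Proof. by move=> cab; rewrite /Xi qent_qmat // mulrN. Qed.

Lemma invmx_qmat c a b : in_cone c a b -> invmx (c^-1 *: qmat a b + half_id R)
  = (4 / relgap c a b) *: (half_id R - c^-1 *: qmat a b).
Proof.
move=> cab; have g0 := relgap_gt0 cab; case: cab => /andP[c0 _] _.
set S := c^-1 *: _ + _; set B := RHS.
have SB : S *m B = 1%:M.
  have gE : c ^+ 2 * relgap c a b = c ^+ 2 - 4 * (a ^+ 2 + b ^+ 2).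
    by rewrite /relgap; field; rewrite gt_eqF.
  have gn : relgap c a b = (c ^+ 2 - 4 * (a ^+ 2 + b ^+ 2)) / c ^+ 2.
    by rewrite -gE; field; rewrite gt_eqF.
  have gp : c ^+ 2 - 4 * (a ^+ 2 + b ^+ 2) != 0.
    by rewrite -gE gt_eqF // mulr_gt0 ?exprn_gt0.
  apply/matrixP => i j; rewrite !mxE sum_ord2 !mxE gn.
  by case: (ord2P i) (ord2P j) => -> [] -> /=; field; rewrite ?gp ?gt_eqF.
have [uS _] := mulmx1_unit SB.
by rewrite -[LHS]mulmx1 -SB mulmxA mulVmx // mul1mx.
Qed.

Lemma dXi_dc_qmat c a b : in_cone c a b -> dXi_dc k c (qmat a b) = grad_c c a b.
Proof.
move=> cab; have g0 := relgap_gt0 cab.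
rewrite /dXi_dc qent_qmat // invmx_qmat // /grad_c !sum_ord2 /half_id !mxE /=.
case: cab => /andP[c0 _] _.
by field; rewrite !gt_eqF.
Qed.

Lemma dXi_dQ_qmat_diag c a b : in_cone c a b ->
  dXi_dQ k c (qmat a b) 0 0 - dXi_dQ k c (qmat a b) 1 1 = grad_a c a b.
Proof.
move=> cab; have g0 := relgap_gt0 cab.
rewrite /dXi_dQ invmx_qmat // /grad_a /half_id !mxE /=.
case: cab => /andP[c0 _] _.
by field; rewrite !gt_eqF.
Qed.

Lemma dXi_dQ_qmat_offdiag c a b : in_cone c a b ->
  dXi_dQ k c (qmat a b) 0 1 + dXi_dQ k c (qmat a b) 1 0 = grad_b c a b.
Proof.
move=> cab; have g0 := relgap_gt0 cab.
rewrite /dXi_dQ invmx_qmat // /grad_b /half_id !mxE /=.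
case: cab => /andP[c0 _] _.
by field; rewrite !gt_eqF.
Qed.

Lemma ln_ge (x : R) : 0 < x -> 1 - x^-1 <= ln x.
Proof.
move=> x0; have h : -1 < x^-1 - 1 by rewrite ltrBDl subrr invr_gt0.
have := le_ln1Dx h; rewrite (_ : 1 + (x^-1 - 1) = x^-1); last by ring.
by rewrite lnV ?posrE //; lra.
Qed.

(** Each logarithm is bounded by [ln_ge] at a ratio of its values at the two points. This settles
    the two mixing terms; the log-determinant leaves the slack computed in [key]. *)
Lemma Xi_grad_ineq c a b c' a' b' : in_cone c a b -> in_cone c' a' b' ->
  grad_c c a b * (c' - c) + grad_a c a b * (a' - a) + grad_b c a b * (b' - b)
  <= Xi k c' (qmat a' b') - Xi k c (qmat a b).
Proof.
move=> cab cab'; rewrite !Xi_qmat //.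
have g0 := relgap_gt0 cab; have g0' := relgap_gt0 cab'.
case: cab cab' => /andP[c0 cM] rc [/andP[c0' cM'] rc'].
have Mc : 0 < cmax k - c by rewrite subr_gt0.
have Mc' : 0 < cmax k - c' by rewrite subr_gt0.
have lnMc x : x < cmax k -> ln (1 - x / cmax k) = ln (cmax k - x) - ln (cmax k).
  move=> xM; rewrite -ln_div ?posrE ?subr_gt0 //; congr ln.
  by field; rewrite gt_eqF.
have e1 := ln_ge (divr_gt0 c0' c0).
have e2 := ln_ge (divr_gt0 Mc' Mc).
have e3 := ln_ge (divr_gt0 g0 g0').
rewrite !ln_div ?posrE // !invf_div in e1 e2 e3.
have {}e1 : c' - c <= c' * (ln c' - ln c).
  apply: le_trans (ler_wpM2l (ltW c0') e1).
  by rewrite mulrBr mulr1 mulrCA divff ?gt_eqF // mulr1.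
have {}e2 : c - c' <= (cmax k - c') * (ln (cmax k - c') - ln (cmax k - c)).
  apply: le_trans (ler_wpM2l (ltW Mc') e2).
  by rewrite mulrBr mulr1 mulrCA divff ?gt_eqF // mulr1; lra.
have {}e3 : c' * nu k * (1 - relgap c' a' b' / relgap c a b)
    <= c' * nu k * (ln (relgap c a b) - ln (relgap c' a' b')).
  by rewrite ler_wpM2l // mulr_ge0 // ltW.
rewrite /grad_c /grad_a /grad_b.
rewrite ln_div ?posrE ?mulr_gt0 // lnM ?posrE // !lnMc //.
(* The slack is an exact multiple of [|Q'/c' - Q/c|^2]. *)
have key : nu k * (c' * (1 - relgap c' a' b' / relgap c a b)
     + 8 * (a ^+ 2 + b ^+ 2) / (c ^+ 2 * relgap c a b) * (c' - c)
     - 8 * a / (c * relgap c a b) * (a' - a) - 8 * b / (c * relgap c a b) * (b' - b))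
  = nu k * (4 * c' * ((a' / c' - a / c) ^+ 2 + (b' / c' - b / c) ^+ 2)
    / relgap c a b).
  congr (_ * _).
  have -> : relgap c' a' b' = 1 - 4 * (a' ^+ 2 + b' ^+ 2) / c' ^+ 2 by [].
  have {1}-> : c' * (1 - (1 - 4 * (a' ^+ 2 + b' ^+ 2) / c' ^+ 2) / relgap c a b)
    = c' * (relgap c a b - (1 - 4 * (a' ^+ 2 + b' ^+ 2) / c' ^+ 2)) / relgap c a b.
    by field; rewrite !gt_eqF.
  rewrite {1}/relgap; move: (relgap c a b) g0 => s s0.
  by field; rewrite !gt_eqF.
have key0 : 0 <= nu k * (4 * c' * ((a' / c' - a / c) ^+ 2 + (b' / c' - b / c) ^+ 2)
    / relgap c a b).
  apply: mulr_ge0; first exact: ltW.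
  apply: divr_ge0; last exact: ltW.
  by rewrite mulr_ge0 ?addr_ge0 ?sqr_ge0 // mulr_ge0 // ltW.
rewrite -key in key0.
have -> : 8 * nu k * (a ^+ 2 + b ^+ 2) / (c ^+ 2 * relgap c a b)
  = nu k * (8 * (a ^+ 2 + b ^+ 2) / (c ^+ 2 * relgap c a b)) by ring.
have -> : 8 * nu k * a / (c * relgap c a b)
  = nu k * (8 * a / (c * relgap c a b)) by ring.
have -> : 8 * nu k * b / (c * relgap c a b)
  = nu k * (8 * b / (c * relgap c a b)) by ring.
move: (8 * (a ^+ 2 + b ^+ 2) / _) (8 * a / _) (8 * b / _) key0 => x y z key0.
move: (relgap c' a' b' / relgap c a b) e3 key0 => w e3 key0.
lra.
Qed.

End LocalPotential.

(** * Weak form, uniqueness and energy law *)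

Section NodewiseBounds.
Variables (R : realType) (N : nat).
Implicit Types (d f g : gridfun R) (A B : 'M[R]_2).

Definition dotm (A B : 'M[R]_2) : R := \sum_(i < 2) \sum_(j < 2) A i j * B i j.

Lemma dotmE A B : dotm A B
  = A 0 0 * B 0 0 + A 0 1 * B 0 1 + (A 1 0 * B 1 0 + A 1 1 * B 1 1).
Proof. by rewrite /dotm !sum_ord2. Qed.

Lemma dotm_ge0 A : 0 <= dotm A A.
Proof. by rewrite dotmE !addr_ge0 // -expr2 sqr_ge0. Qed.

Lemma dotm_eq0 A : dotm A A <= 0 -> A = 0.
Proof.
rewrite dotmE -!expr2 => A0.
have := sqr_ge0 (A 0 0); have := sqr_ge0 (A 0 1).
have := sqr_ge0 (A 1 0); have := sqr_ge0 (A 1 1) => ? ? ? ?.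
apply/matrixP => i j; rewrite mxE; apply/eqP; rewrite -sqrf_eq0 eq_le sqr_ge0 andbT.
by case: (ord2P i) (ord2P j) => -> [] ->; lra.
Qed.

(** [symtl] is the orthogonal projection onto symmetric traceless matrices, hence invisible when
    tested against one of them. *)
Lemma dotm_symtl A (a b : R) : dotm (symtl A) (qmat a b) = dotm A (qmat a b).
Proof. by rewrite !dotmE /symtl !mxE !sum_ord2 /=; field. Qed.

Lemma interiorP l m : interior N l m ->
  exists i j : nat, [/\ l = i%:Z, m = j%:Z, (1 <= i < N)%N & (1 <= j < N)%N].
Proof.
by move=> H; exists `|l|%N, `|m|%N; move: H; rewrite /interior => H; split; lia.
Qed.

Lemma sumP_ge_node f l m : (forall l m, interior N l m -> 0 <= f l m) ->
  interior N l m -> f l m <= sumP N f.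
Proof.
move=> f0 /interiorP [i [j [-> -> iN jN]]]; rewrite /sumP.
rewrite (bigD1_seq i) ?mem_index_iota ?iota_uniq //=.
rewrite (bigD1_seq j) ?mem_index_iota ?iota_uniq //=.
rewrite -addrA lerDl addr_ge0 //.
  rewrite big_seq_cond sumr_ge0 // => n; rewrite mem_index_iota => /andP[nN _].
  by rewrite f0 // interior_nat iN.
rewrite big_seq_cond sumr_ge0 // => p; rewrite mem_index_iota => /andP[pN _].
rewrite big_seq_cond sumr_ge0 // => n; rewrite mem_index_iota => /andP[nN _].
by rewrite f0 // interior_nat pN.
Qed.

Lemma trap_ge_node (f : int -> R) m : (0 < N)%N -> (forall m, 0 <= f m) -> 0 <= m <= N%:Z ->
  f m / 2 <= trap N f.
Proof.
move=> N0 f0 mN; rewrite /trap.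
have [j [jN fj]] : exists j : nat, (0 <= j < N)%N /\ (m = j%:Z \/ m = j%:Z + 1).
  have [mlt|mge] := ltP m N%:Z; first by exists `|m|%N; lia.
  by exists N.-1; lia.
rewrite (bigD1_seq j) ?mem_index_iota ?iota_uniq //=.
have S0 : 0 <= \sum_(i <- index_iota 0 N | i != j) (f i%:Z + f (i%:Z + 1)) / 2.
  by rewrite sumr_ge0 // => i _; rewrite divr_ge0 ?addr_ge0.
have := f0 j%:Z; have := f0 (j%:Z + 1).
by case: fj => -> ? ?; lra.
Qed.

Lemma eq_sumEdge (fx fy gx gy : gridfun R) :
  (forall l m, is_node N l m -> l = 0 \/ l = N%:Z -> fx l m = gx l m) ->
  (forall l m, is_node N l m -> m = 0 \/ m = N%:Z -> fy l m = gy l m) ->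
  sumEdge N fx fy = sumEdge N gx gy.
Proof.
move=> ex ey; rewrite !sumEdgeE; congr (_ + _); apply: eq_trap => i iN.
  by rewrite !ex //; auto; rewrite /is_node; lia.
by rewrite !ey //; auto; rewrite /is_node; lia.
Qed.

Lemma sumEdgeZ a (fx fy : gridfun R) :
  sumEdge N (fun l m => a * fx l m) (fun l m => a * fy l m) = a * sumEdge N fx fy.
Proof.
by rewrite !sumEdgeE -!trapD -trapZ; apply: eq_trap => i _; ring.
Qed.

Lemma sumEdgeD (fx fy gx gy : gridfun R) :
  sumEdge N (fun l m => fx l m + gx l m) (fun l m => fy l m + gy l m)
  = sumEdge N fx fy + sumEdge N gx gy.
Proof.
by rewrite !sumEdgeE -!trapD; apply: eq_trap => i _; ring.
Qed.

Lemma sumEdge_ge_x (fx fy : gridfun R) l m : (0 < N)%N ->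
  (forall l m, 0 <= fx l m) -> (forall l m, 0 <= fy l m) ->
  is_node N l m -> l = 0 \/ l = N%:Z -> fx l m / 2 <= sumEdge N fx fy.
Proof.
move=> N0 fx0 fy0 /andP[_ mN] lE; rewrite sumEdgeE.
have T0 (g : int -> R) : (forall i, 0 <= g i) -> 0 <= trap N g.
  by move=> g0; apply: sumr_ge0 => i _; rewrite divr_ge0 ?addr_ge0.
rewrite trapD; have := T0 (fun l => fy l 0 + fy l N%:Z) (fun=> addr_ge0 (fy0 _ _) (fy0 _ _)).
have := T0 (fx 0) (fx0 _); have := T0 (fx N%:Z) (fx0 _).
have := @trap_ge_node (fx l) m N0 (fx0 _) mN.
by case: lE => -> *; lra.
Qed.

Lemma sumEdge_ge_y (fx fy : gridfun R) l m : (0 < N)%N ->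
  (forall l m, 0 <= fx l m) -> (forall l m, 0 <= fy l m) ->
  is_node N l m -> m = 0 \/ m = N%:Z -> fy l m / 2 <= sumEdge N fx fy.
Proof.
move=> N0 fx0 fy0 /andP[lN _] mE; rewrite sumEdgeE.
have T0 (g : int -> R) : (forall i, 0 <= g i) -> 0 <= trap N g.
  by move=> g0; apply: sumr_ge0 => i _; rewrite divr_ge0 ?addr_ge0.
rewrite addrC trapD.
have := T0 (fun m => fx 0 m + fx N%:Z m) (fun=> addr_ge0 (fx0 _ _) (fx0 _ _)).
have := T0 (fy^~ 0) (fun=> fy0 _ _); have := T0 (fy^~ N%:Z) (fun=> fy0 _ _).
have := @trap_ge_node (fy^~ m) l N0 (fun=> fy0 _ _) lN.
by case: mE => -> *; lra.
Qed.

Lemma sumP_const (x : R) : sumP N (fun _ _ => x) = (cardP N)%:R * x.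
Proof.
rewrite /sumP /cardP !sumr_const_nat -mulrnA subn1.
by rewrite -[LHS]mulr_natl.
Qed.

Lemma cardP_gt0 l m : interior N l m -> (0 < cardP N)%N.
Proof. by move=> /interiorP [i [j [_ _ ? ?]]]; rewrite /cardP muln_gt0; lia. Qed.

Lemma sumP_card0 f : cardP N = 0%N -> sumP N f = 0.
Proof.
move=> card0; rewrite (@eq_sumP _ _ _ (fun _ _ => 0)) ?sumP0 // => l m /cardP_gt0.
by rewrite card0.
Qed.

Lemma sumP_Ghat f : sumP N (Ghat N f) = 0.
Proof.
rewrite /Ghat sumPB sumP_const.
(* Without interior nodes the mean is a division by zero, but the sum is empty. *)
have [card0|cardn0] := eqVneq (cardP N) 0%N.
  by rewrite !sumP_card0 // mul0r mulr0 subr0.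
by rewrite mulrCA divff ?mulr1 ?subrr // pnatr_eq0.
Qed.

(** The subtracted mean is the multiplier of mass conservation; a direction of zero total mass does
    not feel it. *)
Lemma sumP_GhatM f d : sumP N d = 0 ->
  sumP N (fun l m => Ghat N f l m * d l m) = sumP N (fun l m => f l m * d l m).
Proof.
move=> d0; rewrite /Ghat.
rewrite (@eq_sumP _ _ _ (fun l m => f l m * d l m - sumP N f / (cardP N)%:R * d l m)).
  by rewrite sumPB sumPZ d0 mulr0 subr0.
by move=> l m _; rewrite mulrBl.
Qed.

End NodewiseBounds.

(** * The weak form and the convex functional of one time step *)

Section WeakForm.
Variables (R : realType) (k : coeffs R) (N : nat) (h dt : R).
Variables (c0 : gridfun R) (Q0 : gridfun 'M[R]_2).
Hypotheses (adm : admissible k) (N0 : (0 < N)%N) (h0 : 0 < h) (dt0 : 0 < dt).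
Implicit Types (c d : gridfun R) (Q D : gridfun 'M[R]_2) (f g : gridfun R).

Definition boundary_step c :=
  (forall l m, is_node N l m -> l = 0 \/ l = N%:Z ->
     (Dnx h N c l m - Dnx h N c0 l m) / dt = - lap h c l m) /\
  (forall l m, is_node N l m -> m = 0 \/ m = N%:Z ->
     (Dny h N c l m - Dny h N c0 l m) / dt = - lap h c l m).

Definition local_form (x : R) (A : 'M[R]_2) (y : R) (B : 'M[R]_2) : R :=
  dXi_dc k x A * y + dotm (\matrix_(i, j) dXi_dQ k x A i j) B.

Definition force_c c Q : gridfun R := fun l m =>
  2 * (c00 k - gamma k) * c0 l m + Lc k h c Q l m + (c l m - c0 l m) / dt.

Definition force_Q c Q : gridfun 'M[R]_2 := fun l m =>
  \matrix_(i, j) (2 * c02 k * Q0 l m i j + LQ k h c Q i j l m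
                  + (Q l m i j - Q0 l m i j) / dt).

Definition smooth_form c Q d D : gridfun R := fun l m =>
  force_c c Q l m * d l m + dotm (force_Q c Q l m) (D l m).

(* The scheme tested against the direction ([d], [D]). *)
Definition residual c Q d D : gridfun R := fun l m =>
  local_form (c l m) (Q l m) (d l m) (D l m) + smooth_form c Q d D l m.

(** Directions preserving the total mass and the symmetric traceless structure: testing with them
    makes [Ghat] and [symtl] disappear. *)
Definition tangent d D := sumP N d = 0 /\
  forall l m, interior N l m -> exists a b, D l m = qmat a b.

Lemma local_form_le x A y B : physical k x A -> physical k y B ->
  local_form x A (y - x) (B - A) <= Xi k y B - Xi k x A.
Proof.
case: adm => -[M0 nu0] _ _ _ _.
move=> /physicalE [AE xA] /physicalE [BE yB].
apply: le_trans (_ : _ <= Xi k y (qmat (B 0 0) (B 0 1)) - Xi k x (qmat (A 0 0) (A 0 1))) _;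
  last by rewrite -AE -BE.
apply: le_trans (Xi_grad_ineq M0 nu0 xA yB); rewrite le_eqVlt; apply/orP; left.
rewrite /local_form {1 2 3}AE {1}BE dXi_dc_qmat // -dXi_dQ_qmat_diag //.
rewrite -dXi_dQ_qmat_offdiag // dotmE !mxE /=.
by apply/eqP; ring.
Qed.

Lemma physical_gsub c Q c' Q' l m : physical k (c l m) (Q l m) ->
  physical k (c' l m) (Q' l m) -> exists a b, gsub Q' Q l m = qmat a b.
Proof.
move=> /physicalE [QE _] /physicalE [QE' _].
exists (Q' l m 0 0 - Q l m 0 0), (Q' l m 0 1 - Q l m 0 1).
rewrite /gsub {1}QE {1}QE'; apply/matrixP => i j; rewrite !mxE.
by case: (ord2P i) (ord2P j) => -> [] -> //=; ring.
Qed.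

Lemma scheme_weak cb Qb c Q d D : physical_inside k N c0 Q0 ->
  scheme k N h dt cb Qb c0 Q0 c Q -> tangent d D ->
  sumP N (residual c Q d D) = 0.
Proof.
move=> ph0 [ph cE QE _ _] [d0 DE].
set mu := fun l m => dXi_dc k (c l m) (Q l m)
  + 2 * (c00 k - gamma k) * c0 l m + Lc k h c Q l m.
have E : sumP N (fun l m => (c l m - c0 l m) / dt * d l m)
    = - sumP N (fun l m => mu l m * d l m).
  rewrite -(sumP_GhatM mu d0) -sumPN; apply: eq_sumP => l m lm.
  by rewrite cE // mulNr.
rewrite (@eq_sumP _ _ _ (fun l m => (c l m - c0 l m) / dt * d l m + mu l m * d l m)).
  by rewrite sumPD E addNr.
move=> l m lm; have [a [b Dab]] := DE _ _ lm.
set A := \matrix_(a, b) (dXi_dQ k (c l m) (Q l m) a b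
  + 2 * c02 k * Q0 l m a b + LQ k h c Q a b l m).
have F : dotm (Q l m - Q0 l m) (D l m) / dt = - dotm A (D l m).
  rewrite Dab -(dotm_symtl A); set B := (X in dotm X _).
  have G i j : B i j = - dt * symtl A i j.
    rewrite [LHS](_ : _ = Q l m i j - Q0 l m i j); last by rewrite /B !mxE.
    have := QE l m lm i j => /(congr1 (fun x => x * dt)).
    by rewrite divfK ?gt_eqF // mulNr => ->; rewrite mulNr mulrC.
  by rewrite !dotmE !G; field; rewrite gt_eqF.
move: F; rewrite /residual /smooth_form /local_form /force_c /force_Q /mu /A.
rewrite !dotmE !mxE => F.
apply/eqP; rewrite -subr_eq0; apply/eqP.
transitivity (((Q l m 0 0 - Q0 l m 0 0) * D l m 0 0
  + (Q l m 0 1 - Q0 l m 0 1) * D l m 0 1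
  + ((Q l m 1 0 - Q0 l m 1 0) * D l m 1 0
  + (Q l m 1 1 - Q0 l m 1 1) * D l m 1 1)) / dt
  - - ((dXi_dQ k (c l m) (Q l m) 0 0 + 2 * c02 k * Q0 l m 0 0 + LQ k h c Q 0 0 l m) * D l m 0 0
    + (dXi_dQ k (c l m) (Q l m) 0 1 + 2 * c02 k * Q0 l m 0 1 + LQ k h c Q 0 1 l m) * D l m 0 1
    + ((dXi_dQ k (c l m) (Q l m) 1 0 + 2 * c02 k * Q0 l m 1 0 + LQ k h c Q 1 0 l m) * D l m 1 0
    + (dXi_dQ k (c l m) (Q l m) 1 1 + 2 * c02 k * Q0 l m 1 1 + LQ k h c Q 1 1 l m) * D l m 1 1))).
  by ring.
by rewrite F subrr.
Qed.

(** A minimising-movement functional without the quasi-entropy: explicit terms linearised at the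
    previous step, implicit elastic energy, squared increments over [2 dt], and the edge penalty,
    whose variation is to cancel [2 c40 h] times the boundary sum of [(lap c) (D_n d)]. *)
Definition step_smooth c Q : R :=
  h ^+ 2 * sumP N (fun l m =>
     2 * (c00 k - gamma k) * c0 l m * c l m + 2 * c02 k * dotm (Q0 l m) (Q l m)
     + ((c l m - c0 l m) ^+ 2 + dotm (Q l m - Q0 l m) (Q l m - Q0 l m)) / (2 * dt))
  + Eplus k N h c Q
  + c40 k * h / dt * sumEdge N (fun l m => (Dnx h N c l m - Dnx h N c0 l m) ^+ 2)
                        (fun l m => (Dny h N c l m - Dny h N c0 l m) ^+ 2).

Definition step_energy c Q : R :=
  h ^+ 2 * sumP N (fun l m => Xi k (c l m) (Q l m)) + step_smooth c Q.

(** The second-order remainder of the squared increments and of the edge penalty; it is the amount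
    of strict convexity kept for uniqueness. *)
Definition step_dist c Q c' Q' : R :=
  h ^+ 2 / (2 * dt) * sumP N (fun l m => (c' l m - c l m) ^+ 2
        + dotm (Q' l m - Q l m) (Q' l m - Q l m))
  + c40 k * h / dt * sumEdge N (fun l m => (Dnx h N (gsub c' c) l m) ^+ 2)
                        (fun l m => (Dny h N (gsub c' c) l m) ^+ 2).

Lemma eq_on_bnodes_vanishes c Q c' Q' : eq_on_bnodes N c' Q' c Q ->
  vanishes N (gsub c' c).
Proof. by move=> e l m /e [E _]; rewrite /gsub E subrr. Qed.

Lemma boundary_stepE c d : boundary_step c ->
  sumEdge N (fun l m => lap h c l m * Dnx h N d l m)
            (fun l m => lap h c l m * Dny h N d l m)
  = - dt^-1 * sumEdge N (fun l m => (Dnx h N c l m - Dnx h N c0 l m) * Dnx h N d l m)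
                 (fun l m => (Dny h N c l m - Dny h N c0 l m) * Dny h N d l m).
Proof.
move=> [bx bz]; rewrite -sumEdgeZ; apply: eq_sumEdge => l m nd e.
  by rewrite -[lap h c l m]opprK -bx //; ring.
by rewrite -[lap h c l m]opprK -bz //; ring.
Qed.

(** All parts are quadratic, so the gap is exactly [Eplus] of the increment. The boundary equation
    is imposed on [c] alone: cancelling the boundary sum only involves the state at which the
    expansion is made. *)
Lemma step_smooth_convex c Q c' Q' :
  eq_on_bnodes N c' Q' c Q -> boundary_step c ->
  step_smooth c Q + h ^+ 2 * sumP N (smooth_form c Q (gsub c' c) (gsub Q' Q))
    + step_dist c Q c' Q' <= step_smooth c' Q'.
Proof.
move=> eqb bs.
have hn : h != 0 by rewrite gt_eqF.
have dn : dt != 0 by rewrite gt_eqF.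
have EV := Eplus_variation k N0 hn eqb.
have Ep := Eplus_ge0 hn (gsub Q' Q) adm (eq_on_bnodes_vanishes eqb).
rewrite boundary_stepE // in EV.
have edgeE : sumEdge N (fun l m => (Dnx h N c' l m - Dnx h N c0 l m) ^+ 2)
                       (fun l m => (Dny h N c' l m - Dny h N c0 l m) ^+ 2)
  = sumEdge N (fun l m => (Dnx h N c l m - Dnx h N c0 l m) ^+ 2)
              (fun l m => (Dny h N c l m - Dny h N c0 l m) ^+ 2)
  + 2 * sumEdge N (fun l m => (Dnx h N c l m - Dnx h N c0 l m) * Dnx h N (gsub c' c) l m)
              (fun l m => (Dny h N c l m - Dny h N c0 l m) * Dny h N (gsub c' c) l m)
  + sumEdge N (fun l m => (Dnx h N (gsub c' c) l m) ^+ 2)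
              (fun l m => (Dny h N (gsub c' c) l m) ^+ 2).
  rewrite -sumEdgeZ -!sumEdgeD; apply: eq_sumEdge => l m _ _.
    by rewrite Dnx_gsub; ring.
  by rewrite Dny_gsub; ring.
rewrite /step_smooth /step_dist EV edgeE.
set e1 := sumEdge _ _ _; set e2 := sumEdge _ _ _; set e3 := sumEdge _ _ _.
have sumE : sumP N (fun l m =>
     2 * (c00 k - gamma k) * c0 l m * c' l m + 2 * c02 k * dotm (Q0 l m) (Q' l m)
     + ((c' l m - c0 l m) ^+ 2 + dotm (Q' l m - Q0 l m) (Q' l m - Q0 l m)) / (2 * dt))
  = sumP N (fun l m =>
     2 * (c00 k - gamma k) * c0 l m * c l m + 2 * c02 k * dotm (Q0 l m) (Q l m)
     + ((c l m - c0 l m) ^+ 2 + dotm (Q l m - Q0 l m) (Q l m - Q0 l m)) / (2 * dt))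
  + sumP N (smooth_form c Q (gsub c' c) (gsub Q' Q))
  - sumP N (pairing k h c Q (gsub c' c) (gsub Q' Q))
  + (2 * dt)^-1 * sumP N (fun l m => (c' l m - c l m) ^+ 2
        + dotm (Q' l m - Q l m) (Q' l m - Q l m)).
  rewrite -sumPZ -sumPD -sumPB -sumPD.
  apply: eq_sumP => l m lm.
  rewrite /smooth_form /force_c /force_Q /pairing /comp /gsub !dotmE !sum_ord2 !mxE.
  by field.
rewrite sumE -subr_ge0; apply: le_trans Ep _; rewrite le_eqVlt; apply/orP; left.
by apply/eqP; field.
Qed.

Lemma step_dist_ge0 c Q c' Q' : 0 <= step_dist c Q c' Q'.
Proof.
have [_ [c40p _ _] _ _ _] := adm.
rewrite addr_ge0 // mulr_ge0 //.
- by rewrite divr_ge0 ?sqr_ge0 // mulr_ge0 // ltW.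
- by apply: sumP_ge0 => l m _; rewrite addr_ge0 ?sqr_ge0 ?dotm_ge0.
- by rewrite divr_ge0 ?(ltW dt0) // mulr_ge0 // ltW.
- by apply: sumEdge_ge0 => l m; rewrite sqr_ge0.
Qed.

(* Critical points of [step_energy] are the solutions of one time step. *)
Lemma step_energy_convex c Q c' Q' :
  physical_inside k N c Q -> physical_inside k N c' Q' ->
  eq_on_bnodes N c' Q' c Q -> boundary_step c ->
  step_energy c Q + h ^+ 2 * sumP N (residual c Q (gsub c' c) (gsub Q' Q))
    + step_dist c Q c' Q' <= step_energy c' Q'.
Proof.
move=> ph ph' eqb bs; have := step_smooth_convex eqb bs.
have : sumP N (fun l m => Xi k (c l m) (Q l m)
                 + local_form (c l m) (Q l m) (c' l m - c l m) (Q' l m - Q l m))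
    <= sumP N (fun l m => Xi k (c' l m) (Q' l m)).
  by apply: ler_sumP => l m lm; rewrite -lerBrDl local_form_le //; auto.
move=> /(ler_wpM2l (sqr_ge0 h)); rewrite sumPD /residual sumPD /step_energy => *.
lra.
Qed.

End WeakForm.

(** * Uniqueness and the energy law *)

Section Consequences.
Variables (R : realType) (k : coeffs R) (N : nat) (h dt : R).
Variables (c0 cb : gridfun R) (Q0 Qb : gridfun 'M[R]_2).
Hypotheses (adm : admissible k) (N0 : (0 < N)%N) (h0 : 0 < h) (dt0 : 0 < dt).
Hypotheses (ph0 : physical_inside k N c0 Q0) (eqb0 : eq_on_bnodes N c0 Q0 cb Qb).
Implicit Types (c d : gridfun R) (Q D : gridfun 'M[R]_2) (f g : gridfun R).

Notation solution := (scheme k N h dt cb Qb c0 Q0).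

Lemma scheme_mass c Q : solution c Q -> sumP N (gsub c c0) = 0.
Proof.
move=> [_ cE _ _ _]; set mu := (X in Ghat N X) in cE.
rewrite (@eq_sumP _ _ _ (fun l m => - dt * Ghat N mu l m)).
  by rewrite sumPZ sumP_Ghat mulr0.
move=> l m lm; rewrite mulNr -mulrN -cE // /gsub mulrC divfK ?gt_eqF //.
Qed.

Lemma tangent_gsub c Q c' Q' : physical_inside k N c Q -> physical_inside k N c' Q' ->
  sumP N (gsub c c0) = 0 -> sumP N (gsub c' c0) = 0 ->
  tangent N (gsub c' c) (gsub Q' Q).
Proof.
move=> ph ph' mc mc'; split; last first.
  by move=> l m lm; apply: physical_gsub (ph l m lm) (ph' l m lm).
rewrite (@eq_sumP _ _ _ (fun l m => gsub c' c0 l m - gsub c c0 l m)).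
  by rewrite sumPB mc mc' subrr.
by move=> l m _; rewrite /gsub; ring.
Qed.

Lemma eq_on_bnodes_trans c Q c' Q' :
  eq_on_bnodes N c Q cb Qb -> eq_on_bnodes N c' Q' cb Qb -> eq_on_bnodes N c' Q' c Q.
Proof. by move=> e e' l m b; have [-> ->] := e l m b; have [-> ->] := e' l m b. Qed.

Lemma scheme_unique c Q c' Q' : solution c Q -> solution c' Q' ->
  same_data N h c Q c' Q'.
Proof.
move=> S S'; have mc := scheme_mass S; have mc' := scheme_mass S'.
have [ph _ _ bs eb] := S; have [ph' _ _ bs' eb'] := S'.
have W := scheme_weak dt0 ph0 S (tangent_gsub ph ph' mc mc').
have W' := scheme_weak dt0 ph0 S' (tangent_gsub ph' ph mc' mc).
have := step_energy_convex Q0 adm N0 h0 dt0 ph ph' (eq_on_bnodes_trans eb eb') bs.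
have := step_energy_convex Q0 adm N0 h0 dt0 ph' ph (eq_on_bnodes_trans eb' eb) bs'.
(* With both residuals zero, the two inequalities add up to the statement that a sum of two
   nonnegative distances is at most zero. *)
rewrite W W' mulr0 !addr0 => I I'.
have [_ [c40p _ _] _ _ _] := adm.
have hdt : 0 < h ^+ 2 / (2 * dt) by rewrite divr_gt0 ?exprn_gt0 // mulr_gt0.
have cdt : 0 < c40 k * h / dt by rewrite divr_gt0 // mulr_gt0.
pose f l m := (c' l m - c l m) ^+ 2 + dotm (Q' l m - Q l m) (Q' l m - Q l m).
pose ex l m := (Dnx h N (gsub c' c) l m) ^+ 2.
pose ey l m := (Dny h N (gsub c' c) l m) ^+ 2.
have f0 l m : 0 <= f l m by rewrite addr_ge0 ?sqr_ge0 ?dotm_ge0.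
have ex0 l m : 0 <= ex l m by rewrite sqr_ge0.
have ey0 l m : 0 <= ey l m by rewrite sqr_ge0.
have P0 : 0 <= sumP N f by apply: sumP_ge0.
have E0 : 0 <= sumEdge N ex ey by apply: sumEdge_ge0.
have dist0 := step_dist_ge0 N adm h0 dt0 c' Q' c Q.
have distE : step_dist k N h dt c Q c' Q'
  = h ^+ 2 / (2 * dt) * sumP N f + c40 k * h / dt * sumEdge N ex ey by [].
have p1 := mulr_ge0 (ltW hdt) P0; have p2 := mulr_ge0 (ltW cdt) E0.
have fz : sumP N f <= 0.
  by rewrite -(ler_pM2l hdt) mulr0; lra.
have ez : sumEdge N ex ey <= 0.
  by rewrite -(ler_pM2l cdt) mulr0; lra.
split.
- move=> l m nd; have [lm|lm] := boolP (interior N l m); last first.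
    by have [] := eq_on_bnodes_trans eb' eb (l := l) (m := m); rewrite /bnode ?nd.
  have := le_trans (sumP_ge_node (fun l m _ => f0 l m) lm) fz.
  rewrite /f => fle; have s0 := sqr_ge0 (c' l m - c l m).
  have q0 := dotm_ge0 (Q' l m - Q l m).
  have /eqP : (c' l m - c l m) ^+ 2 = 0 by lra.
  rewrite sqrf_eq0 subr_eq0 => /eqP ->; split=> //.
  apply/eqP; rewrite eq_sym -subr_eq0; apply/eqP/dotm_eq0; lra.
- move=> l m nd e; have := le_trans (sumEdge_ge_x N0 ex0 ey0 nd e) ez.
  rewrite /ex Dnx_gsub => le0; have := sqr_ge0 (Dnx h N c' l m - Dnx h N c l m) => ge0.
  have /eqP : (Dnx h N c' l m - Dnx h N c l m) ^+ 2 = 0 by lra.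
  by rewrite sqrf_eq0 subr_eq0 => /eqP.
- move=> l m nd e; have := le_trans (sumEdge_ge_y N0 ex0 ey0 nd e) ez.
  rewrite /ey Dny_gsub => le0; have := sqr_ge0 (Dny h N c' l m - Dny h N c l m) => ge0.
  have /eqP : (Dny h N c' l m - Dny h N c l m) ^+ 2 = 0 by lra.
  by rewrite sqrf_eq0 subr_eq0 => /eqP.
Qed.

Lemma cell_prod_even i j u v u' v' l m :
  cell_prod h i j (gsub u' u) (gsub v' v) l m
  = cell_prod h i j (gsub u u') (gsub v v') l m.
Proof.
by case: (ord2P i) (ord2P j) => -> [] ->;
  rewrite /cell_prod /= /cell_D1D1 /cell_D2D2 /cell_D1D2 /gsub; congr (_ / _); ring.
Qed.

Lemma Eplus_even c Q c' Q' :
  Eplus k N h (gsub c' c) (gsub Q' Q) = Eplus k N h (gsub c c') (gsub Q Q').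
Proof.
rewrite !EplusE; congr (_ * _ + _ * _); last first.
  by apply: eq_sumP => l m _; rewrite /gsub -sqrrN opprB.
apply: eq_sumCell => l m _ _; rewrite /elastic_density.
have E i j a b a' b' := @cell_prod_even i j (comp Q a b) (comp Q a' b') (comp Q' a b)
  (comp Q' a' b') l m.
have E' i j a b := @cell_prod_even i j c (comp Q a b) c' (comp Q' a b) l m.
have E'' i j := @cell_prod_even i j c c c' c' l m.
rewrite !sum_ord2 !comp_gsub !E !E' !E'' /cell_avg !lap_gsub; ring.
Qed.

Lemma scheme_energy_law A c Q : boundary_determined N A -> solution c Q ->
  energy_law k N h dt A c0 Q0 c Q.
Proof.
move=> bA S; have mc := scheme_mass S; have [ph _ _ bs eb] := S.
have hn : h != 0 by rewrite gt_eqF.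
have dn : dt != 0 by rewrite gt_eqF.
have m0 : sumP N (gsub c0 c0) = 0.
  rewrite -[RHS](sumP0 R N); apply: eq_sumP => l m _; exact: subrr.
have W := scheme_weak dt0 ph0 S (tangent_gsub ph ph0 mc m0).
(* The expansion is made at the new step, towards the old one, since the equations hold at the new
   step; [Eplus_even] then reverses the increment. *)
have EV := Eplus_variation k N0 hn (eq_on_bnodes_trans eb eqb0).
rewrite (boundary_stepE _ bs) in EV.
have AE : A c Q = A c0 Q0.
  by apply: bA; apply: eq_on_bnodes_trans eqb0 eb.
rewrite /energy_law /Ehat AE EV Eplus_even.
set e1 := sumEdge _ _ _; set e2 := sumEdge _ _ _.
(* Here the full first variation appears, which is why the law carries [2 c40 h / dt] where the
   functional has [c40 h / dt]. *)
have -> : e2 = - e1.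
  rewrite -mulN1r -sumEdgeZ; apply: eq_sumEdge => l m _ _.
    by rewrite Dnx_gsub; ring.
  by rewrite Dny_gsub; ring.
rewrite /Eminus.
set s1 := sumP _ _; set s2 := sumP _ _; set s3 := sumP _ _; set s4 := sumP _ _.
set s5 := sumP _ _; set s6 := sumP _ _; set s7 := sumP _ _.
(* What remains holds node by node. The identity [x^2 - (x - x0)^2 - x0^2 = 2 x0 (x - x0)] accounts
   for the explicit terms, so the only inequality used is that of the quasi-entropy. *)
have main : s1 - s2 + ((1 - (c00 k - gamma k) * dt) / dt * s3
    + (1 - c02 k * dt) / dt * s4) - s5 - s6 + s7 <= 0.
  rewrite -[leRHS]oppr0 -W -[leRHS]sumPN /s1 /s2 /s3 /s4 /s5 /s6 /s7 -!sumPZ -sumPB -sumPD -sumPD -!sumPB -sumPD.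
  apply: ler_sumP => l m lm.
  have LF := local_form_le adm (ph _ _ lm) (ph0 lm).
  rewrite /residual /smooth_form /force_c /force_Q -[gsub c0 c l m]/(c0 l m - c l m) -[gsub Q0 Q l m]/(Q0 l m - Q l m).
  move: (local_form _ _ _ _ _) LF => lf LF.
  rewrite -subr_ge0.
  apply: le_trans (_ : 0 <= Xi k (c0 l m) (Q0 l m) - Xi k (c l m) (Q l m) - lf) _.
    by rewrite subr_ge0.
  rewrite le_eqVlt; apply/orP; left; apply/eqP.
  by rewrite /pairing /comp /gsub !dotmE !sum_ord2 !mxE; field.
have {}main := ler_wpM2l (sqr_ge0 h) main.
rewrite -subr_ge0; rewrite mulr0 -subr_ge0 in main.
apply: le_trans main _; rewrite le_eqVlt; apply/orP; left; apply/eqP.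
by field.
Qed.

End Consequences.

(** * Existence *)

Section LocalCoercivity.
Variables (R : realType) (k : coeffs R).
Hypotheses (M0 : 0 < cmax k) (nu0 : 0 < nu k).
Local Notation M := (cmax k).
Local Notation in_cone := (in_cone k).
Local Notation grad_c := (grad_c k).
Local Notation grad_a := (grad_a k).
Local Notation grad_b := (grad_b k).

Definition slope (c a b dc da db : R) :=
  grad_c c a b * dc + grad_a c a b * da + grad_b c a b * db.

Lemma slope_monotone c a b c' a' b' : in_cone c a b -> in_cone c' a' b' ->
  slope c a b (c' - c) (a' - a) (b' - b) <= slope c' a' b' (c' - c) (a' - a) (b' - b).
Proof.
move=> x y; have := Xi_grad_ineq M0 nu0 x y; have := Xi_grad_ineq M0 nu0 y x.
rewrite /slope; move: (Xi _ _ _) (Xi _ _ _) => ? ? *; nra.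
Qed.

Lemma in_cone_bounds c a b : in_cone c a b ->
  [/\ 0 <= c <= M, - M <= a <= M & - M <= b <= M].
Proof. by move=> [/andP[? ?] ?]; split; apply/andP; split; nra. Qed.

Lemma ler_mul_norm (x y B : R) : - B <= y <= B -> x * y <= `|x| * B.
Proof.
move=> yB; apply: le_trans (ler_norm _) _; rewrite normrM.
by rewrite ler_wpM2l // ler_norml.
Qed.

(** Bounds the slope at this point towards or away from any other point of the truncated cone, since
    coordinates differ by at most [2 M]. *)
Definition probe_bound c a b :=
  2 * M * (`|grad_c c a b| + `|grad_a c a b| + `|grad_b c a b|).

Lemma probe_bound_ge0 c a b : 0 <= probe_bound c a b.
Proof. by rewrite mulr_ge0 ?mulr_ge0 ?(ltW M0) // !addr_ge0. Qed.

(** Monotonicity trades the uncontrolled gradient at the moving point for the one at the fixed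
    probe. *)
Lemma slope_probe c a b c' a' b' : in_cone c a b -> in_cone c' a' b' ->
  slope c a b (c' - c) (a' - a) (b' - b) <= probe_bound c' a' b'.
Proof.
move=> x y; apply: le_trans (slope_monotone x y) _.
have [/andP[? ?] /andP[? ?] /andP[? ?]] := in_cone_bounds x.
have [/andP[? ?] /andP[? ?] /andP[? ?]] := in_cone_bounds y.
have -> : probe_bound c' a' b' = `|grad_c c' a' b'| * (2 * M)
    + `|grad_a c' a' b'| * (2 * M) + `|grad_b c' a' b'| * (2 * M).
  by rewrite /probe_bound; ring.
rewrite /slope; apply: lerD; first apply: lerD.
- by apply: ler_mul_norm; apply/andP; split; lra.
- by apply: ler_mul_norm; apply/andP; split; lra.
- by apply: ler_mul_norm; apply/andP; split; lra.
Qed.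

(* Testing monotonicity against the six neighbours of a fixed interior point
   controls the whole gradient by the slope towards that point. *)
Lemma gradient_le_slope c' a' b' : in_cone c' a' b' ->
  exists rho C, [/\ 0 < rho, 0 <= C & forall c a b, in_cone c a b ->
    let s := slope c a b (c' - c) (a' - a) (b' - b) in
    [/\ rho * `|grad_c c a b| + s <= C, rho * `|grad_a c a b| + s <= C
      & rho * `|grad_b c a b| + s <= C]].
Proof.
move=> [/andP[c0 cM] rc].
set e := c' ^+ 2 - 4 * (a' ^+ 2 + b' ^+ 2).
have e0 : 0 < e by rewrite subr_gt0.
have eM0 : 0 < e / (16 * M) by rewrite divr_gt0 // mulr_gt0.
(* Keeps all six neighbours in the cone: a shift of one coordinate by [rho] lowers
   [c^2 - 4 (a^2 + b^2)] by at most [12 rho M], which is less than [e], and the other two bounds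
   keep c between 0 and M. *)
pose rho := Num.min (e / (16 * M)) (Num.min ((M - c') / 2) (c' / 2)).
have rho0 : 0 < rho by rewrite !lt_min eM0 /=; lra.
have r1 : rho * (16 * M) <= e.
  by rewrite -ler_pdivlMr ?mulr_gt0 // ge_min lexx.
have r2 : rho <= (M - c') / 2 by rewrite !ge_min lexx orbT.
have r3 : rho <= c' / 2 by rewrite !ge_min lexx !orbT.
have [_ /andP[a1 a2] /andP[b1 b2]] : [/\ 0 <= c' <= M, - M <= a' <= M & - M <= b' <= M].
  by apply: in_cone_bounds; split; rewrite ?c0.
have rM : 0 < rho * M by rewrite mulr_gt0.
have rr : rho * rho <= rho * M by rewrite ler_pM2l //; lra.
have ra1 : rho * a' <= rho * M by rewrite ler_pM2l.
have ra2 : - (rho * M) <= rho * a' by rewrite -mulrN ler_pM2l.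
have rb1 : rho * b' <= rho * M by rewrite ler_pM2l.
have rb2 : - (rho * M) <= rho * b' by rewrite -mulrN ler_pM2l.
have rc1 : rho * c' <= rho * M by rewrite ler_pM2l // ltW.
have rc2 : 0 <= rho * c' by rewrite mulr_ge0 // ltW.
have z1 : in_cone (c' + rho) a' b'.
  by split; [apply/andP; split; lra | rewrite /e in r1; nra].
have z2 : in_cone (c' - rho) a' b'.
  by split; [apply/andP; split; lra | rewrite /e in r1; nra].
have z3 : in_cone c' (a' + rho) b'.
  by split; [apply/andP; split; lra | rewrite /e in r1; nra].
have z4 : in_cone c' (a' - rho) b'.
  by split; [apply/andP; split; lra | rewrite /e in r1; nra].
have z5 : in_cone c' a' (b' + rho).
  by split; [apply/andP; split; lra | rewrite /e in r1; nra].
have z6 : in_cone c' a' (b' - rho).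
  by split; [apply/andP; split; lra | rewrite /e in r1; nra].
have p1 := probe_bound_ge0 (c' + rho) a' b'.
have p2 := probe_bound_ge0 (c' - rho) a' b'.
have p3 := probe_bound_ge0 c' (a' + rho) b'.
have p4 := probe_bound_ge0 c' (a' - rho) b'.
have p5 := probe_bound_ge0 c' a' (b' + rho).
have p6 := probe_bound_ge0 c' a' (b' - rho).
exists rho, (probe_bound (c' + rho) a' b' + probe_bound (c' - rho) a' b'
  + (probe_bound c' (a' + rho) b' + probe_bound c' (a' - rho) b')
  + (probe_bound c' a' (b' + rho) + probe_bound c' a' (b' - rho))).
split=> //; first by rewrite !addr_ge0.
move=> c a b x s.
have q1 := slope_probe x z1; have q2 := slope_probe x z2.
have q3 := slope_probe x z3; have q4 := slope_probe x z4.
have q5 := slope_probe x z5; have q6 := slope_probe x z6.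
rewrite /slope in q1 q2 q3 q4 q5 q6; rewrite /s /slope {s}.
clear -p1 p2 p3 p4 p5 p6 q1 q2 q3 q4 q5 q6.
by split; case: ger0P => _; lra.
Qed.

(** The components [grad_a] and [grad_b] keep the eigenvalues away from their limits by bounding
    [relgap] below; then [grad_c] controls the logarithm of [M c / (M - c)] and keeps c away from 0
    and M. The conclusion is the condition later called [shrunk eta]. *)
Lemma slope_coercive (Kb : R) : 0 <= Kb -> exists2 eta, 0 < eta &
  forall c a b, in_cone c a b ->
    `|grad_c c a b| <= Kb -> `|grad_a c a b| <= Kb -> `|grad_b c a b| <= Kb ->
    [/\ eta <= c, c <= M - eta & 4 * (a ^+ 2 + b ^+ 2) <= (c - eta) ^+ 2].
Proof.
move=> K0.
(* With g = [relgap c a b], the bounds on [grad_a] and [grad_b] give [16 nu^2 (1 - g) <= 2 Kb^2 g^2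
   <= 2 Kb^2 g]; solving for g yields [g0]. *)
pose g0 := 16 * nu k ^+ 2 / (2 * Kb ^+ 2 + 16 * nu k ^+ 2).
have den0 : 0 < 2 * Kb ^+ 2 + 16 * nu k ^+ 2.
  by rewrite ltr_wpDl ?mulr_ge0 ?sqr_ge0 // mulr_gt0 ?exprn_gt0.
have g0_gt0 : 0 < g0 by rewrite divr_gt0 // mulr_gt0 ?exprn_gt0.
have g0_le1 : g0 <= 1.
  by rewrite ler_pdivrMr // mul1r lerDr mulr_ge0 ?sqr_ge0.
(* Bounds the logarithm of [M c / (M - c)]: the other terms of [grad_c] cost at most [nu / g0] and
   [2 nu / g0]. *)
pose T := Kb + nu k / g0 + 2 * nu k / g0.
pose E := expR (- T); have E0 : 0 < E by rewrite expR_gt0.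
(* The value of c at which [M c / (M - c)] equals [E]. *)
pose cmin := E * M / (M + E).
have cmin0 : 0 < cmin by rewrite divr_gt0 ?mulr_gt0 // addr_gt0.
(* The first entry bounds [M - c] from below; the second gives [2 c eta <= c^2 g0], hence the
   shifted cone condition. *)
pose eta := Num.min (E * M * cmin) (g0 * cmin / 2).
have eta0 : 0 < eta.
  rewrite lt_min (mulr_gt0 (mulr_gt0 E0 M0) cmin0) /=.
  by apply: divr_gt0 => //; apply: mulr_gt0.
have eta1 : eta <= E * M * cmin by rewrite ge_min lexx.
have eta2 : eta <= g0 * cmin / 2 by rewrite ge_min lexx orbT.
exists eta => // c a b x Kc Ka Kb'.
have g_gt0 := relgap_gt0 x; have g_le1 := relgap_le1 c a b.
have [/andP[c_gt0 cM] rc] := x.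
have Mc : 0 < M - c by rewrite subr_gt0.
have gE : c ^+ 2 * relgap c a b = c ^+ 2 - 4 * (a ^+ 2 + b ^+ 2).
  by rewrite /relgap; field; rewrite gt_eqF.
have sq (u v : R) : `|u| <= v -> u ^+ 2 <= v ^+ 2.
  by move=> uv; rewrite -real_normK ?num_real // ler_sqr ?nnegrE //; apply: le_trans uv.
have g0_le : g0 <= relgap c a b.
  have := lerD (sq _ _ Ka) (sq _ _ Kb').
  have -> : grad_a c a b ^+ 2 + grad_b c a b ^+ 2
    = 16 * nu k ^+ 2 * (4 * (a ^+ 2 + b ^+ 2)) / (c * relgap c a b) ^+ 2.
    by rewrite /grad_a /grad_b; field; rewrite !gt_eqF.
  have -> : 4 * (a ^+ 2 + b ^+ 2) = c ^+ 2 * (1 - relgap c a b).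
    by rewrite mulrBr gE mulr1; ring.
  rewrite ler_pdivrMr ?exprn_gt0 ?mulr_gt0 // => ineq.
  rewrite ler_pdivrMr //.
  have c2 : 0 < c ^+ 2 by rewrite exprn_gt0.
  have {}ineq : 16 * nu k ^+ 2 * (1 - relgap c a b) <= 2 * Kb ^+ 2 * relgap c a b ^+ 2.
    by rewrite -(ler_pM2l c2); rewrite exprMn in ineq; lra.
  have K2 : 0 <= 2 * Kb ^+ 2 by rewrite mulr_ge0 ?sqr_ge0.
  have : 2 * Kb ^+ 2 * relgap c a b ^+ 2 <= 2 * Kb ^+ 2 * relgap c a b.
    by rewrite ler_wpM2l // expr2 ger_pMl.
  by move: ineq; lra.
have ginv : (relgap c a b)^-1 <= g0^-1 by rewrite lef_pV2 ?posrE.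
have lng0 : - ln (relgap c a b) <= g0^-1.
  by have := ln_ge g_gt0; lra.
have lng1 : ln (relgap c a b) <= 0 by rewrite ln_le0.
have gcE : ln (M * c / (M - c)) = grad_c c a b + nu k * ln (relgap c a b)
    + 2 * nu k * ((relgap c a b)^-1 - 1).
  rewrite /grad_c.
  have -> : 8 * nu k * (a ^+ 2 + b ^+ 2) = 2 * nu k * (c ^+ 2 * (1 - relgap c a b)).
    by rewrite mulrBr gE mulr1; ring.
  by field; rewrite !gt_eqF.
have ginv1 : 1 <= (relgap c a b)^-1 by rewrite invf_ge1.
move: Kc; rewrite ler_norml => /andP[Kc1 Kc2].
have TE : T = Kb + 3 * (nu k * g0^-1) by rewrite /T; ring.
have aux (n y gi z w : R) : 0 < n -> 1 <= y <= gi -> - gi <= z <= 0 -> - Kb <= w <= Kb ->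
    - (Kb + 3 * (n * gi)) <= w + n * z + 2 * n * (y - 1) <= Kb + 3 * (n * gi).
  move=> n0 /andP[y1 yg] /andP[z1 z2] /andP[w1 w2].
  have n1 : n * (- gi) <= n * z by rewrite ler_pM2l.
  have n2 : n * z <= 0 by rewrite pmulr_rle0.
  have n3 : n * 1 <= n * y by rewrite ler_pM2l.
  have n4 : n * y <= n * gi by rewrite ler_pM2l.
  by apply/andP; split; lra.
have /andP[lT' lT] : - T <= ln (M * c / (M - c)) <= T.
  by rewrite gcE TE; apply: aux; rewrite // ?ginv1 ?Kc1 // lng1 andbT lerNl.
have q0 : 0 < M * c / (M - c) by rewrite divr_gt0 // mulr_gt0.
have e1 : E * (M - c) <= M * c.
  by rewrite -ler_pdivlMr // -[leRHS]lnK ?posrE // ler_expR.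
have e2 : E * (M * c) <= M - c.
  have : M * c / (M - c) <= E^-1.
    by rewrite /E expRN invrK -[leLHS]lnK ?posrE // ler_expR.
  by rewrite ler_pdivrMr // ler_pdivlMl.
have cc : cmin <= c.
  by rewrite ler_pdivrMr ?addr_gt0 //; lra.
split.
- by apply: le_trans eta2 _; nra.
- have : eta <= M - c by apply: le_trans eta1 (le_trans _ e2); rewrite -mulrA !ler_pM2l.
  lra.
- have : c ^+ 2 * g0 <= c ^+ 2 * relgap c a b by rewrite ler_pM2l ?exprn_gt0.
  have : 2 * (c * eta) <= c ^+ 2 * g0.
    have : eta <= g0 * c / 2 by apply: le_trans eta2 _; rewrite ler_pM2r ?ler_pM2l ?invr_gt0.
    by move=> ?; nra.
  by rewrite gE; nra.
Qed.

End LocalCoercivity.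

(** * Ghost values determined by the boundary equation *)

Section GhostExtension.
Variables (R : realType) (N : nat) (h dt : R) (c0 : gridfun R).
Hypotheses (N0 : (0 < N)%N) (h0 : 0 < h) (dt0 : 0 < dt).
Implicit Types (w : gridfun R).

Definition fold_index (l : int) : int :=
  if l == -1 then 1 else if l == N%:Z + 1 then N%:Z - 1 else l.

(* Even reflection: the extension with zero normal differences. *)
Definition fold_field w : gridfun R := fun l m => w (fold_index l) (fold_index m).

Definition on_side (l : int) : R := ((l == 0) || (l == N%:Z))%:R.

(* At a boundary node the Laplacian is that of the reflection plus (2 / h) times
   the normal differences occurring there (two at a corner); inserting the
   boundary equation leaves a scalar linear equation, solved here. *)
Definition boundary_lap w : gridfun R := fun l m =>
  (lap h (fold_field w) l m
   + 2 / h * (on_side l * Dnx h N c0 l m + on_side m * Dny h N c0 l m))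
  / (1 + 2 * dt / h * (on_side l + on_side m)).

(** At a ghost node the reflection is corrected by [2 h] times the normal difference that the
    boundary equation prescribes, with [boundary_lap] standing for the Laplacian not yet known. *)
Definition ghost_ext w : gridfun R := fun l m =>
  fold_field w l m
  + 2 * h * ((l == -1)%:R * (Dnx h N c0 0 m - dt * boundary_lap w 0 m)
             + (l == N%:Z + 1)%:R * (Dnx h N c0 N%:Z m - dt * boundary_lap w N%:Z m))
  + 2 * h * ((m == -1)%:R * (Dny h N c0 l 0 - dt * boundary_lap w l 0)
             + (m == N%:Z + 1)%:R * (Dny h N c0 l N%:Z - dt * boundary_lap w l N%:Z)).

Lemma fold_index_node l : 0 <= l <= N%:Z -> fold_index l = l.
Proof. by move=> ln; rewrite /fold_index; do 2?[case: eqP; first lia]. Qed.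

Lemma ghost_ext_node w l m : is_node N l m -> ghost_ext w l m = w l m.
Proof.
move=> /andP[ln mn]; rewrite /ghost_ext /fold_field !fold_index_node //.
have -> : (l == -1) = false by lia.
have -> : (l == N%:Z + 1) = false by lia.
have -> : (m == -1) = false by lia.
have -> : (m == N%:Z + 1) = false by lia.
by rewrite !mul0r !addr0 !mulr0 !addr0.
Qed.

Lemma ghost_ext_x w l m : 0 <= m <= N%:Z -> ghost_ext w l m = fold_field w l m
  + 2 * h * ((l == -1)%:R * (Dnx h N c0 0 m - dt * boundary_lap w 0 m)
             + (l == N%:Z + 1)%:R * (Dnx h N c0 N%:Z m - dt * boundary_lap w N%:Z m)).
Proof.
move=> mn; rewrite /ghost_ext.
have -> : (m == -1) = false by lia.
have -> : (m == N%:Z + 1) = false by lia.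
by rewrite !mul0r addr0 mulr0 addr0.
Qed.

Lemma ghost_ext_y w l m : 0 <= l <= N%:Z -> ghost_ext w l m = fold_field w l m
  + 2 * h * ((m == -1)%:R * (Dny h N c0 l 0 - dt * boundary_lap w l 0)
             + (m == N%:Z + 1)%:R * (Dny h N c0 l N%:Z - dt * boundary_lap w l N%:Z)).
Proof.
move=> ln; rewrite /ghost_ext.
have -> : (l == -1) = false by lia.
have -> : (l == N%:Z + 1) = false by lia.
by rewrite !mul0r addr0 mulr0 addr0.
Qed.

Lemma Dnx_ghost_ext w l m : is_node N l m -> l = 0 \/ l = N%:Z ->
  Dnx h N (ghost_ext w) l m = Dnx h N c0 l m - dt * boundary_lap w l m.
Proof.
move=> /andP[_ mn] lE; rewrite {1}/Dnx !ghost_ext_x //.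
have -> : (1 == -1 :> int) = false by [].
have -> : (1 == N%:Z + 1) = false by lia.
have -> : (N%:Z - 1 == N%:Z + 1) = false by lia.
have -> : (N%:Z - 1 == -1) = false by lia.
have -> : (N%:Z + 1 == -1) = false by lia.
have -> : (-1 == N%:Z + 1) = false by lia.
rewrite !eqxx.
have fE : fold_field w (-1) m = fold_field w 1 m.
  by rewrite /fold_field [fold_index 1]fold_index_node //; lia.
have fE' : fold_field w (N%:Z + 1) m = fold_field w (N%:Z - 1) m.
  rewrite /fold_field [fold_index (N%:Z - 1)]fold_index_node; last lia.
  by rewrite /fold_index eqxx; case: eqP; first lia.
rewrite fE fE'; case: lE => ->; rewrite ?eqxx; last first.
  have -> : (N%:Z == 0) = false by lia.
  by rewrite /=; field; rewrite gt_eqF.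
by rewrite /=; field; rewrite gt_eqF.
Qed.

Lemma Dny_ghost_ext w l m : is_node N l m -> m = 0 \/ m = N%:Z ->
  Dny h N (ghost_ext w) l m = Dny h N c0 l m - dt * boundary_lap w l m.
Proof.
move=> /andP[ln _] mE; rewrite {1}/Dny !ghost_ext_y //.
have -> : (1 == -1 :> int) = false by [].
have -> : (1 == N%:Z + 1) = false by lia.
have -> : (N%:Z - 1 == N%:Z + 1) = false by lia.
have -> : (N%:Z - 1 == -1) = false by lia.
have -> : (N%:Z + 1 == -1) = false by lia.
have -> : (-1 == N%:Z + 1) = false by lia.
rewrite !eqxx.
have fE : fold_field w l (-1) = fold_field w l 1.
  by rewrite /fold_field [fold_index 1]fold_index_node //; lia.
have fE' : fold_field w l (N%:Z + 1) = fold_field w l (N%:Z - 1).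
  rewrite /fold_field [fold_index (N%:Z - 1)]fold_index_node; last lia.
  by rewrite /fold_index eqxx; case: eqP; first lia.
rewrite fE fE'; case: mE => ->; rewrite ?eqxx; last first.
  have -> : (N%:Z == 0) = false by lia.
  by rewrite /=; field; rewrite gt_eqF.
by rewrite /=; field; rewrite gt_eqF.
Qed.

(** Closes the loop: the number solved for in [boundary_lap] is the Laplacian of the field built
    from it. The scalar equation is solvable because its coefficient is at least 1. *)
Lemma lap_ghost_ext w l m : is_node N l m ->
  lap h (ghost_ext w) l m = boundary_lap w l m.
Proof.
move=> /andP[ln mn].
pose X l := Dnx h N c0 l m - dt * boundary_lap w l m.
pose Y m := Dny h N c0 l m - dt * boundary_lap w l m.
have Ex : ((l - 1 == -1)%:R * X 0 + (l - 1 == N%:Z + 1)%:R * X N%:Z)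
  + ((l + 1 == -1)%:R * X 0 + (l + 1 == N%:Z + 1)%:R * X N%:Z) = on_side l * X l.
  have -> : (l - 1 == N%:Z + 1) = false by lia.
  have -> : (l + 1 == -1) = false by lia.
  have -> : (l - 1 == -1) = (l == 0) by lia.
  have -> : (l + 1 == N%:Z + 1) = (l == N%:Z) by lia.
  rewrite !mul0r addr0 add0r /on_side.
  have [->|_] := eqVneq l 0.
    have -> : (0 == N%:Z) = false by lia.
    by rewrite mul0r addr0.
  by have [->|_] := eqVneq l N%:Z; rewrite !mul0r add0r.
have Ey : ((m - 1 == -1)%:R * Y 0 + (m - 1 == N%:Z + 1)%:R * Y N%:Z)
  + ((m + 1 == -1)%:R * Y 0 + (m + 1 == N%:Z + 1)%:R * Y N%:Z) = on_side m * Y m.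
  have -> : (m - 1 == N%:Z + 1) = false by lia.
  have -> : (m + 1 == -1) = false by lia.
  have -> : (m - 1 == -1) = (m == 0) by lia.
  have -> : (m + 1 == N%:Z + 1) = (m == N%:Z) by lia.
  rewrite !mul0r addr0 add0r /on_side.
  have [->|_] := eqVneq m 0.
    have -> : (0 == N%:Z) = false by lia.
    by rewrite mul0r addr0.
  by have [->|_] := eqVneq m N%:Z; rewrite !mul0r add0r.
have -> : lap h (ghost_ext w) l m = lap h (fold_field w) l m
    + 2 / h * (on_side l * X l + on_side m * Y m).
  rewrite -Ex -Ey /lap /D11 /D22 (@ghost_ext_node w l m); last by rewrite /is_node ln mn.
  rewrite !(ghost_ext_x _ _ mn) !(ghost_ext_y _ _ ln) -!/(X _) -!/(Y _).
  have -> : w l m = fold_field w l m by rewrite /fold_field !fold_index_node.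
  by field; rewrite gt_eqF.
rewrite /X /Y; set s := on_side l; set t := on_side m.
have s0 : 0 <= s by rewrite ler0n.
have t0 : 0 <= t by rewrite ler0n.
have den : h + 2 * dt * (s + t) != 0.
  by rewrite gt_eqF // ltr_pwDl // mulr_ge0 ?addr_ge0 // mulr_ge0 // ltW.
rewrite /boundary_lap -/s -/t.
by field; rewrite [h == 0]gt_eqF //= addrC den.
Qed.

Lemma ghost_ext_boundary_step w : boundary_step N h dt c0 (ghost_ext w).
Proof.
split=> l m nd e; rewrite ?Dnx_ghost_ext ?Dny_ghost_ext ?lap_ghost_ext //.
  by rewrite /=; field; rewrite gt_eqF.
by rewrite /=; field; rewrite gt_eqF.
Qed.

End GhostExtension.

(** * Pointwise continuity of arithmetic expressions *)

Section ContinuousAt.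
Variables (R : realType) (T : topologicalType) (x : T).
Implicit Types (f g : T -> R).

Definition cont_at f : Prop := {for x, continuous f}.

Lemma cont_cst (a : R) : cont_at (fun _ => a).
Proof. exact: cst_continuous. Qed.

Lemma contD f g : cont_at f -> cont_at g -> cont_at (fun y => f y + g y).
Proof. exact: continuousD. Qed.

Lemma contN f : cont_at f -> cont_at (fun y => - f y).
Proof. exact: continuousN. Qed.

Lemma contM f g : cont_at f -> cont_at g -> cont_at (fun y => f y * g y).
Proof. exact: continuousM. Qed.

Lemma contV f : f x != 0 -> cont_at f -> cont_at (fun y => (f y)^-1).
Proof. exact: continuousV. Qed.

Lemma contX f n : cont_at f -> cont_at (fun y => f y ^+ n).
Proof.
move=> cf; elim: n => [|n IH]; first exact: cont_cst.
rewrite (_ : (fun y => _) = (fun y => f y * f y ^+ n)); first exact: contM.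
by apply/funext => y; rewrite exprS.
Qed.

Lemma cont_ln f : 0 < f x -> cont_at f -> cont_at (fun y => ln (f y)).
Proof.
by move=> f0 cf; apply: (@continuous_comp _ _ _ f (@ln R)) => //; exact: continuous_ln.
Qed.

Lemma cont_sum (I : Type) (r : seq I) (F : I -> T -> R) :
  (forall i, cont_at (F i)) -> cont_at (fun y => \sum_(i <- r) F i y).
Proof.
move=> cF; elim: r => [|i r IH].
  by rewrite (_ : (fun y => _) = (fun=> 0)); [exact: cont_cst | apply/funext => y; rewrite big_nil].
rewrite (_ : (fun y => _) = (fun y => F i y + \sum_(j <- r) F j y)); first exact: contD.
by apply/funext => y; rewrite big_cons.
Qed.

Lemma cont_sum_nat (a b : nat) (F : nat -> T -> R) :
  (forall i, (a <= i < b)%N -> cont_at (F i)) ->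
  cont_at (fun y => \sum_(a <= i < b) F i y).
Proof.
move=> cF; rewrite (_ : (fun y => _) = (fun y => \sum_(i <- index_iota a b)
    if (a <= i < b)%N then F i y else 0)).
  apply: cont_sum => i; have [iab|_] := boolP (a <= i < b)%N; first exact: cF.
    exact: cont_cst.
by apply/funext => y; apply: eq_big_nat => i ->.
Qed.

End ContinuousAt.

(** * A variational inequality on a compact convex set *)

Section ConvexMinimum.
Variables (R : realType) (n : nat).
Local Open Scope classical_set_scope.

(* No derivative of [F] is computed: minimality of [F] at x and the convexity
   inequality at x + t (y - x) give 0 <= G (x + t (y - x)) (y - x) for t > 0,
   and [G] is continuous. The convexity inequality, used at x and at y, also
   makes [F] continuous. *)
Lemma convex_variational_inequality (K : set 'rV[R]_n) (F : 'rV[R]_n -> R)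
    (G : 'rV[R]_n -> 'rV[R]_n -> R) :
  compact K -> K !=set0 ->
  (forall x y (t : R), K x -> K y -> 0 < t <= 1 -> K (x + t *: (y - x))) ->
  (forall x y, K x -> K y -> F x + G x (y - x) <= F y) ->
  (forall x (t : R) (d : 'rV[R]_n), G x (t *: d) = t * G x d) ->
  (forall x d : 'rV[R]_n, cont_at x (fun y => G x (d + y))) ->
  (forall (x d : 'rV[R]_n) (e : R), K x -> cont_at x (fun y => G y (d + e *: y))) ->
  exists2 x, K x & forall y, K y -> 0 <= G x (y - x).
Proof.
move=> cK K0 convK FG GZ cG cG'.
have Gx0 x : G x 0 = 0 by rewrite -(scale0r (0 : 'rV_n)) GZ mul0r.
have cF : {within K, continuous F}.
  apply/subspace_continuousP => x Kx.
  have lo : (F x + G x (y - x)) @[y --> within K (nbhs x)] --> F x.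
    rewrite -[X in _ --> X]addr0; apply: cvgD; first exact: cvg_cst.
    rewrite -(Gx0 x) -(subrr x).
    apply: cvg_trans (_ : G x (y - x) @[y --> x] --> G x (x - x)).
      exact/cvg_app/cvg_within.
    have -> : (fun y => G x (y - x)) = (fun y => G x (- x + y)).
      by apply/funext => y; rewrite addrC.
    by rewrite (addrC x); exact: cG.
  have hi : (F x + G y (y - x)) @[y --> within K (nbhs x)] --> F x.
    rewrite -[X in _ --> X]addr0; apply: cvgD; first exact: cvg_cst.
    rewrite -(Gx0 x) -(subrr x).
    apply: cvg_trans (_ : G y (y - x) @[y --> x] --> G x (x - x)).
      exact/cvg_app/cvg_within.
    have -> : (fun y => G y (y - x)) = (fun y => G y (- x + 1 *: y)).
      by apply/funext => y; rewrite scale1r addrC.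
    by rewrite -{4}(scale1r x) (addrC (1 *: x)); exact: cG'.
  apply: squeeze_cvgr lo hi.
  apply: filterS (withinT _ _) => // y Ky; apply/andP; split; first exact: FG.
  have := FG _ _ Ky Kx; rewrite -(opprB y x) -scaleN1r GZ mulN1r.
  by rewrite lerBlDr.
have [x + minx] := compact_EVT_min K0 cK cF; rewrite inE => Kx.
exists x => // y Ky; rewrite leNgt; apply/negP => Gneg.
have cGt : (fun t : R => G (x + t *: (y - x)) (y - x)) t @[t --> (0 : R)] -->
    G (x + 0 *: (y - x)) (y - x).
  have c0 := cG' x (y - x) 0 Kx.
  have cg : {for 0 : R, continuous (fun t : R => x + t *: (y - x))}.
    apply: continuousD; first exact: cst_continuous.
    by apply: continuousZr_tmp.
  rewrite (_ : (fun z => _) = (fun z => G z (y - x))) in c0; last first.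
    by apply/funext => z; rewrite scale0r addr0.
  apply: (@continuous_comp _ _ _ (fun t : R => x + t *: (y - x))
    (fun z => G z (y - x)) 0 cg).
  by rewrite scale0r addr0; exact: c0.
rewrite scale0r addr0 in cGt.
have : \forall t \near (0 : R)^'+, G (x + t *: (y - x)) (y - x) < 0.
  exact: cvgr_lt (cvg_at_right_filter cGt) _ Gneg.
move=> near_neg.
have : \forall t \near (0 : R)^'+, False.
  near=> t.
  have t0 : 0 < t by near: t; exact: nbhs_right_gt.
  have t1 : t <= 1 by near: t; exact: nbhs_right_le.
  have tn : G (x + t *: (y - x)) (y - x) < 0 by near: t.
  have Kt : K (x + t *: (y - x)) by apply: convK; rewrite ?t0.
  have := FG _ _ Kt Kx; rewrite opprD addrA subrr add0r -scaleNr GZ.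
  have := minx (x + t *: (y - x)); rewrite inE => /(_ Kt) m1 m2.
  have : t * G (x + t *: (y - x)) (y - x) < 0 by rewrite pmulr_rlt0.
  lra.
by move=> /filter_ex [].
Unshelve. all: by end_near.
Qed.

End ConvexMinimum.

(** Descends through the arithmetic, leaving the atomic functions and the nonvanishing of variable
    denominators. *)
Ltac cont_auto := cbv beta; lazymatch goal with
  | |- cont_at ?x (fun _ => ?a) => exact (@cont_cst _ _ x a)
  | |- cont_at ?x (fun y => @?f y + @?g y) => apply (@contD _ _ x f g); cont_auto
  | |- cont_at ?x (fun y => - @?f y) => apply (@contN _ _ x f); cont_auto
  | |- cont_at ?x (fun y => @?f y * @?g y) => apply (@contM _ _ x f g); cont_auto
  | |- cont_at ?x (fun y => @?f y ^+ ?n) => apply (@contX _ _ x f n); cont_auto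
  | |- cont_at ?x (fun y => (@?f y)^-1) => apply (@contV _ _ x f); [cbv beta | cont_auto]
  | |- _ => cbv beta; try assumption
  end.

(** * The unknowns as a row vector *)

Section Coordinates.
Variables (R : realType) (N : nat).

(* Coordinates of the unknown: a node, and one of [None] (for c),
   [Some false] (for Q_11), [Some true] (for Q_12); those attached to boundary
   nodes are dummies, kept equal to 0. *)
Definition coord_type : finType := ('I_N.+1 * 'I_N.+1 * option bool)%type.
Local Notation dim := #|{: coord_type}|.
Local Notation vec := 'rV[R]_dim.
Implicit Types (x y d : vec) (t : option bool).

(** Total in [l] and [m] through the absolute value and [inord]; the result is meaningful at nodes
    only. *)
Definition coord t (l m : int) : 'I_dim :=
  enum_rank ((inord `|l|%N, inord `|m|%N, t) : coord_type).

Definition get x t : gridfun R := fun l m => x 0 (coord t l m).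

Definition used (i : 'I_dim) : bool :=
  let: (p, q, _) := (enum_val i : 'I_N.+1 * 'I_N.+1 * option bool) in interior N p%:Z q%:Z.

Definition vec_of (f : option bool -> gridfun R) : vec :=
  \row_i (let: (p, q, t) := (enum_val i : 'I_N.+1 * 'I_N.+1 * option bool) in
          if interior N p%:Z q%:Z then f t p%:Z q%:Z else 0).

Lemma get_vec_of f t l m : interior N l m -> get (vec_of f) t l m = f t l m.
Proof.
move=> lm; rewrite /get mxE /coord enum_rankK.
have [lE mE] : `|l|%N%:Z = l /\ `|m|%N%:Z = m by move: lm; rewrite /interior; lia.
have [lN mN] : (`|l| < N.+1)%N /\ (`|m| < N.+1)%N by move: lm; rewrite /interior; lia.
by rewrite !inordK // lE mE lm.
Qed.

Lemma vec_of_unused f i : ~~ used i -> vec_of f 0 i = 0.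
Proof. by rewrite mxE /used; case: (enum_val i) => -[p q] t /negbTE ->. Qed.

Lemma used_coord x i : used i -> exists l m t, interior N l m /\ x 0 i = get x t l m.
Proof.
rewrite /used; case E : (enum_val i) => [[p q] t] lm.
exists p%:Z, q%:Z, t; split=> //; congr (x 0 _).
by rewrite /coord /= !inord_val -E enum_valK.
Qed.

Lemma getD x y t l m : get (x + y) t l m = get x t l m + get y t l m.
Proof. by rewrite /get mxE. Qed.

Lemma getB x y t l m : get (x - y) t l m = get x t l m - get y t l m.
Proof. by rewrite /get !mxE. Qed.

Lemma getZ (a : R) x t l m : get (a *: x) t l m = a * get x t l m.
Proof. by rewrite /get mxE. Qed.

Lemma interior_node l m : interior N l m -> is_node N l m.
Proof. by rewrite /interior /is_node; lia. Qed.

End Coordinates.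

(** * The functional and its gradient in coordinates *)

Section ParametrizedFields.
Variables (R : realType) (k : coeffs R) (N : nat) (h dt : R).
Variables (c0 cb : gridfun R) (Q0 Qb : gridfun 'M[R]_2).
Hypotheses (adm : admissible k) (N0 : (0 < N)%N) (h0 : 0 < h) (dt0 : 0 < dt).
Local Notation M := (cmax k).

Local Notation vec := 'rV[R]_#|{: coord_type N}|.
Implicit Types (x y d : vec) (t : option bool).

Definition cnode x : gridfun R := fun l m =>
  if interior N l m then get x None l m else cb l m.

Definition Qnode x : gridfun 'M[R]_2 := fun l m =>
  if interior N l m then qmat (get x (Some false) l m) (get x (Some true) l m)
  else Qb l m.

Definition cfield x : gridfun R := ghost_ext N h dt c0 (cnode x).

Lemma cfield_interior x l m : interior N l m -> cfield x l m = get x None l m.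
Proof.
by move=> lm; rewrite /cfield ghost_ext_node ?interior_node // /cnode lm.
Qed.

Lemma Qnode_interior x l m : interior N l m ->
  Qnode x l m = qmat (get x (Some false) l m) (get x (Some true) l m).
Proof. by move=> lm; rewrite /Qnode lm. Qed.

Lemma fields_bnodes x : eq_on_bnodes N (cfield x) (Qnode x) cb Qb.
Proof.
move=> l m /andP[nd /negbTE lm].
by rewrite /cfield ghost_ext_node // /cnode /Qnode lm.
Qed.

Lemma fields_eq_on_bnodes x y : eq_on_bnodes N (cfield y) (Qnode y) (cfield x) (Qnode x).
Proof.
by move=> l m b; have [-> ->] := fields_bnodes x b; have [-> ->] := fields_bnodes y b.
Qed.

Definition fc x : gridfun R := force_c k h dt c0 (cfield x) (Qnode x).

(** Chain rule along [qmat]: a enters both diagonal entries with opposite signs, and for [fb] the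
    coordinate b enters both off-diagonal ones. *)
Definition fa x : gridfun R := fun l m =>
  force_Q k h dt Q0 (cfield x) (Qnode x) l m 0 0
  - force_Q k h dt Q0 (cfield x) (Qnode x) l m 1 1.

Definition fb x : gridfun R := fun l m =>
  force_Q k h dt Q0 (cfield x) (Qnode x) l m 0 1
  + force_Q k h dt Q0 (cfield x) (Qnode x) l m 1 0.

Definition smooth_grad x d : R := sumP N (fun l m =>
  fc x l m * get d None l m + fa x l m * get d (Some false) l m
  + fb x l m * get d (Some true) l m).

Definition slope_grad x d : R := sumP N (fun l m =>
  slope k (get x None l m) (get x (Some false) l m) (get x (Some true) l m)
    (get d None l m) (get d (Some false) l m) (get d (Some true) l m)).

Definition grad x d : R := slope_grad x d + smooth_grad x d.

Lemma smooth_gradE x y :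
  sumP N (smooth_form k h dt c0 Q0 (cfield x) (Qnode x)
            (gsub (cfield y) (cfield x)) (gsub (Qnode y) (Qnode x)))
  = smooth_grad x (y - x).
Proof.
apply: eq_sumP => l m lm; rewrite /smooth_form /gsub.
rewrite dotmE !(Qnode_interior _ lm) !(cfield_interior _ lm) !mxE /= !getB.
rewrite /fc /fa /fb !mxE.
by ring.
Qed.

Definition in_cones x := forall l m, interior N l m ->
  in_cone k (get x None l m) (get x (Some false) l m) (get x (Some true) l m).

Lemma physical_qmat (c a b : R) : in_cone k c a b -> physical k c (qmat a b).
Proof.
move=> cab; apply/physicalE; rewrite !mxE /=; split=> //.
Qed.

Lemma in_cones_physical x : in_cones x -> physical_inside k N (cfield x) (Qnode x).
Proof.
move=> cx l m lm; rewrite cfield_interior // Qnode_interior //.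
exact/physical_qmat/cx.
Qed.

Lemma gradE x y : in_cones x ->
  sumP N (residual k h dt c0 Q0 (cfield x) (Qnode x)
            (gsub (cfield y) (cfield x)) (gsub (Qnode y) (Qnode x)))
  = grad x (y - x).
Proof.
move=> cx; rewrite /grad -smooth_gradE /slope_grad -sumPD.
apply: eq_sumP => l m lm; rewrite /residual; congr (_ + _).
rewrite /local_form /gsub !(Qnode_interior _ lm) !(cfield_interior _ lm).
have cab := cx l m lm.
rewrite dXi_dc_qmat // dotmE !mxE /= !getB /slope.
rewrite -(dXi_dQ_qmat_diag cab) -(dXi_dQ_qmat_offdiag cab).
by ring.
Qed.

Definition potential x : R :=
  (h ^+ 2)^-1 * step_energy k N h dt c0 Q0 (cfield x) (Qnode x).

Lemma potential_convex x y : in_cones x -> in_cones y ->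
  potential x + grad x (y - x) <= potential y.
Proof.
move=> cx cy.
have := step_energy_convex Q0 adm N0 h0 dt0 (in_cones_physical cx)
  (in_cones_physical cy) (fields_eq_on_bnodes x y)
  (ghost_ext_boundary_step c0 N0 h0 dt0 (cnode x)).
rewrite gradE // => ineq; rewrite /potential.
have h2 : 0 < h ^+ 2 by rewrite exprn_gt0.
rewrite -(ler_pM2l h2) mulrDr !mulVKf ?gt_eqF //.
by apply: le_trans ineq; rewrite lerDl; exact: step_dist_ge0.
Qed.

(** Stated for the smooth part alone, which couples the nodes; in the gradient bound it moves that
    part to a fixed state while the quasi-entropy is handled node by node. *)
Lemma smooth_grad_monotone x y : smooth_grad x (y - x) <= smooth_grad y (y - x).
Proof.
have h2 : 0 < h ^+ 2 by rewrite exprn_gt0.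
have bs z := ghost_ext_boundary_step c0 N0 h0 dt0 (cnode z).
have := step_smooth_convex Q0 adm N0 h0 dt0 (fields_eq_on_bnodes x y) (bs x).
have := step_smooth_convex Q0 adm N0 h0 dt0 (fields_eq_on_bnodes y x) (bs y).
rewrite !smooth_gradE.
have := step_dist_ge0 N adm h0 dt0 (cfield x) (Qnode x) (cfield y) (Qnode y).
have := step_dist_ge0 N adm h0 dt0 (cfield y) (Qnode y) (cfield x) (Qnode x).
have -> : smooth_grad y (x - y) = - smooth_grad y (y - x).
  by rewrite /smooth_grad -sumPN; apply: eq_sumP => l m _; rewrite !getB; ring.
move=> *; rewrite -(ler_pM2l h2); lra.
Qed.

Lemma gradZ x (a : R) d : grad x (a *: d) = a * grad x d.
Proof.
rewrite /grad /slope_grad /smooth_grad mulrDr -!sumPZ; congr (_ + _);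
  by apply: eq_sumP => l m _; rewrite /slope !getZ; ring.
Qed.

Lemma cont_get x t l m : cont_at x (fun y => get y t l m).
Proof. exact: coord_continuous. Qed.

Section FieldContinuity.
Variable x : vec.

Definition cont_field (u : vec -> gridfun R) :=
  forall l m, cont_at x (fun y => u y l m).

Lemma cont_D11 u : cont_field u -> cont_field (fun y => D11 h (u y)).
Proof. by move=> cu l m; rewrite /D11; cont_auto; exact: cu. Qed.

Lemma cont_D22 u : cont_field u -> cont_field (fun y => D22 h (u y)).
Proof. by move=> cu l m; rewrite /D22; cont_auto; exact: cu. Qed.

Lemma cont_D12 u : cont_field u -> cont_field (fun y => D12 h (u y)).
Proof. by move=> cu l m; rewrite /D12; cont_auto; exact: cu. Qed.

Lemma cont_lap u : cont_field u -> cont_field (fun y => lap h (u y)).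
Proof.
by move=> cu l m; apply: contD; [exact: cont_D11 | exact: cont_D22].
Qed.

Lemma cont_bilap u : cont_field u -> cont_field (fun y => bilap h (u y)).
Proof.
move=> cu l m; rewrite /bilap; apply: contD; first apply: contD.
- exact: cont_D11 (cont_D11 cu) l m.
- by apply: contM; [exact: cont_cst | exact: cont_D11 (cont_D22 cu) l m].
- exact: cont_D22 (cont_D22 cu) l m.
Qed.

Lemma cont_DD i j u : cont_field u -> cont_field (fun y => DD h i j (u y)).
Proof.
move=> cu; rewrite /DD; case: eqP => _; last exact: cont_D12.
by case: eqP => _; [exact: cont_D11 | exact: cont_D22].
Qed.

Lemma cont_ghost_ext u : cont_field u -> cont_field (fun y => ghost_ext N h dt c0 (u y)).
Proof.
move=> cu.
have cf : cont_field (fun y => fold_field N (u y)) by move=> l m; exact: cu.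
have cl := cont_lap cf.
have cb' : cont_field (fun y => boundary_lap N h dt c0 (u y)).
  by move=> l m; rewrite /boundary_lap; cont_auto; exact: cl.
move=> l m; rewrite /ghost_ext; cont_auto; first [exact: cf | exact: cb'].
Qed.

Lemma cont_cnode : cont_field cnode.
Proof.
move=> l m; rewrite /cnode; case: (interior N l m); first exact: cont_get.
exact: cont_cst.
Qed.

Lemma cont_cfield : cont_field cfield.
Proof. exact: cont_ghost_ext cont_cnode. Qed.

Lemma cont_Qnode i j : cont_field (fun y => comp (Qnode y) i j).
Proof.
move=> l m; rewrite /comp /Qnode; case: (interior N l m); last exact: cont_cst.
rewrite (_ : (fun y => _) = (fun y => if i == j then
    if i == 0 then get y (Some false) l m else - get y (Some false) l m
    else get y (Some true) l m)); last by apply/funext => y; rewrite mxE.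
by case: (i == j); [case: (i == 0) |]; cont_auto; exact: cont_get.
Qed.

Lemma cont_fc : cont_field fc.
Proof.
move=> l m; rewrite /fc /force_c /Lc.
rewrite (_ : (fun y => _) = (fun y => 2 * (c00 k - gamma k) * c0 l m
  + (2 * gamma k * cfield y l m
     - 2 * c20 k * (DD h 0 0 (cfield y) l m + DD h 1 1 (cfield y) l m)
     - c23 k * (DD h 0 0 (comp (Qnode y) 0 0) l m + DD h 0 1 (comp (Qnode y) 0 1) l m
              + (DD h 1 0 (comp (Qnode y) 1 0) l m + DD h 1 1 (comp (Qnode y) 1 1) l m))
     + 2 * c40 k * bilap h (cfield y) l m) + (cfield y l m - c0 l m) / dt));
  last by apply/funext => y; rewrite !sum_ord2.
have h1 := cont_cfield; have h2 i j := @cont_DD i j _ h1.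
have h3 i j a b := @cont_DD a b _ (@cont_Qnode i j); have h4 := cont_bilap h1.
cont_auto; lazymatch goal with
  | |- cont_at _ (fun y => cfield y _ _) => exact: h1
  | |- cont_at _ (fun y => bilap _ _ _ _) => exact: h4
  | |- cont_at _ (fun y => DD _ ?i ?j (cfield y) _ _) => exact: (h2 i j)
  | |- cont_at _ (fun y => DD _ ?i ?j (comp (Qnode y) ?a ?b) _ _) =>
      exact: (h3 a b i j)
  end.
Qed.

Lemma cont_force_Q i j :
  cont_field (fun y l m => force_Q k h dt Q0 (cfield y) (Qnode y) l m i j).
Proof.
move=> l m; rewrite /force_Q /LQ.
rewrite (_ : (fun y => _) = (fun y => 2 * c02 k * Q0 l m i j
  + (- 2 * c21 k * (DD h 0 0 (comp (Qnode y) i j) l m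
                    + DD h 1 1 (comp (Qnode y) i j) l m)
     - 2 * c22 k * (DD h i 0 (comp (Qnode y) 0 j) l m
                    + DD h i 1 (comp (Qnode y) 1 j) l m)
     - c23 k * DD h i j (cfield y) l m)
  + (comp (Qnode y) i j l m - Q0 l m i j) / dt));
  last by apply/funext => y; rewrite mxE !sum_ord2.
have h1 a b := @cont_DD a b _ cont_cfield; have h2 := cont_Qnode.
have h3 i' j' a b := @cont_DD a b _ (@cont_Qnode i' j').
cont_auto; lazymatch goal with
  | |- cont_at _ (fun y => comp _ ?a ?b _ _) => exact: (h2 a b)
  | |- cont_at _ (fun y => DD _ ?a ?b (cfield y) _ _) => exact: (h1 a b)
  | |- cont_at _ (fun y => DD _ ?a ?b (comp (Qnode y) ?c ?d) _ _) =>
      exact: (h3 c d a b)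
  end.
Qed.

Lemma cont_fa : cont_field fa.
Proof. by move=> l m; apply: contD; [|apply: contN]; exact: cont_force_Q. Qed.

Lemma cont_fb : cont_field fb.
Proof. by move=> l m; apply: contD; exact: cont_force_Q. Qed.

Lemma cont_gradients (c a b : vec -> R) : cont_at x c -> cont_at x a -> cont_at x b ->
  in_cone k (c x) (a x) (b x) ->
  [/\ cont_at x (fun y => grad_c k (c y) (a y) (b y)),
      cont_at x (fun y => grad_a k (c y) (a y) (b y)) &
      cont_at x (fun y => grad_b k (c y) (a y) (b y))].
Proof.
have [[M0 _] _ _ _ _] := adm.
move=> cc ca cb' cab; have g0 := relgap_gt0 cab; have [/andP[c_gt0 cM] _] := cab.
have cg : cont_at x (fun y => relgap (c y) (a y) (b y)).
  by rewrite /relgap; cont_auto; rewrite expf_neq0 ?gt_eqF.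
split.
- have cq : cont_at x (fun y => M * c y / (M - c y)).
    by cont_auto; rewrite gt_eqF ?subr_gt0.
  have cl : cont_at x (fun y => ln (M * c y / (M - c y))).
    by apply: cont_ln cq; rewrite divr_gt0 ?mulr_gt0 ?subr_gt0.
  have cl' : cont_at x (fun y => ln (relgap (c y) (a y) (b y))) by exact: cont_ln cg.
  rewrite /grad_c; cont_auto.
  by rewrite mulf_neq0 ?expf_neq0 // gt_eqF.
- by rewrite /grad_a; cont_auto; rewrite mulf_neq0 // gt_eqF.
- by rewrite /grad_b; cont_auto; rewrite mulf_neq0 // gt_eqF.
Qed.

Lemma cont_sumP (u : vec -> gridfun R) :
  (forall l m, interior N l m -> cont_at x (fun y => u y l m)) ->
  cont_at x (fun y => sumP N (u y)).
Proof.
move=> cu; rewrite /sumP.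
apply: (cont_sum_nat (F := fun l y => \sum_(1 <= m < N) u y l%:Z m%:Z)) => l lN.
apply: (cont_sum_nat (F := fun m y => u y l%:Z m%:Z)) => m mN.
by apply: cu; rewrite interior_nat lN mN.
Qed.

End FieldContinuity.
End ParametrizedFields.

(** * Shrunk feasible sets, the uniform bound and the solution *)

Section Existence.
Variables (R : realType) (k : coeffs R) (N : nat) (h dt : R).
Variables (c0 cb : gridfun R) (Q0 Qb : gridfun 'M[R]_2).
Hypotheses (adm : admissible k) (N0 : (0 < N)%N) (h0 : 0 < h) (dt0 : 0 < dt).
Hypothesis ph0 : physical_inside k N c0 Q0.
Local Notation M := (cmax k).
Local Notation vec := 'rV[R]_#|{: coord_type N}|.
Local Notation Xc x := (get x None).
Local Notation Xa x := (get x (Some false)).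
Local Notation Xb x := (get x (Some true)).
Local Notation cfield := (cfield h dt c0 cb).
Local Notation Qnode := (Qnode Qb).
Local Notation grad := (grad k h dt c0 cb Q0 Qb).
Local Notation smooth_grad := (smooth_grad k h dt c0 cb Q0 Qb).
Local Notation slope_grad := (slope_grad k).
Local Notation fc := (fc k h dt c0 cb Qb).
Local Notation fa := (fa k h dt c0 cb Q0 Qb).
Local Notation fb := (fb k h dt c0 cb Q0 Qb).
Implicit Types (x y d : vec) (eta : R).

(* The shifted cone makes [shrunk eta] closed and convex. *)
Definition shrunk eta (c a b : R) : Prop :=
  [/\ eta <= c, c <= M - eta & 4 * (a ^+ 2 + b ^+ 2) <= (c - eta) ^+ 2].

Lemma shrunk_in_cone eta c a b : 0 < eta -> shrunk eta c a b -> in_cone k c a b.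
Proof.
move=> e0 [ec cM r]; split; first by apply/andP; split; lra.
by apply: le_lt_trans r _; nra.
Qed.

(** Cauchy-Schwarz, through the Lagrange identity. As [shrunk] uses a translated cone, this yields
    both its convexity and its stability under small shifts. *)
Lemma cone_add (c a b c' a' b' : R) : 0 <= c -> 0 <= c' ->
  4 * (a ^+ 2 + b ^+ 2) <= c ^+ 2 -> 4 * (a' ^+ 2 + b' ^+ 2) <= c' ^+ 2 ->
  4 * ((a + a') ^+ 2 + (b + b') ^+ 2) <= (c + c') ^+ 2.
Proof.
move=> c_ge0 c'_ge0 r r'.
have cs : 4 * (a * a' + b * b') <= c * c'.
  have cc : 0 <= c * c' by rewrite mulr_ge0.
  have [neg|pos] := lerP (4 * (a * a' + b * b')) 0; first exact: le_trans neg cc.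
  rewrite -ler_sqr ?nnegrE ?(ltW pos) //.
  have -> : (4 * (a * a' + b * b')) ^+ 2 = 4 * (a ^+ 2 + b ^+ 2) * (4 * (a' ^+ 2 + b' ^+ 2))
    - 16 * (a * b' - b * a') ^+ 2 by ring.
  have -> : (c * c') ^+ 2 = c ^+ 2 * c' ^+ 2 by rewrite exprMn.
  have m1 : 4 * (a ^+ 2 + b ^+ 2) * (4 * (a' ^+ 2 + b' ^+ 2)) <= c ^+ 2 * c' ^+ 2.
    by apply: ler_pM => //; rewrite mulr_ge0 ?addr_ge0 ?sqr_ge0.
  by apply: le_trans m1; rewrite gerBl mulr_ge0 ?sqr_ge0.
lra.
Qed.

Lemma shrunk_add eta c a b u v w : 0 < eta -> shrunk (2 * eta) c a b ->
  `|u| <= eta / 4 -> `|v| <= eta / 4 -> `|w| <= eta / 4 ->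
  shrunk eta (c + u) (a + v) (b + w).
Proof.
rewrite !ler_norml => e0 [ec cM r] /andP[u1 u2] /andP[v1 v2] /andP[w1 w2].
split; [lra | lra |].
(* The shift [(eta + u, v, w)] lies in the cone, because [4 (v^2 + w^2) <= eta^2 / 2 <= (3 eta /
   4)^2]. *)
have -> : c + u - eta = (c - 2 * eta) + (eta + u) by ring.
apply: cone_add => //; [lra | lra |].
have sq (z B : R) : - B <= z -> z <= B -> z ^+ 2 <= B ^+ 2 by move=> *; nra.
have v3 := sq v _ v1 v2; have w3 := sq w _ w1 w2.
nra.
Qed.

Lemma shrunk_convex eta c a b c' a' b' (t : R) : 0 < t <= 1 ->
  shrunk eta c a b -> shrunk eta c' a' b' ->
  shrunk eta (c + t * (c' - c)) (a + t * (a' - a)) (b + t * (b' - b)).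
Proof.
move=> /andP[t0 t1] [ec cM r] [ec' cM' r'].
have s0 : 0 <= 1 - t by lra.
have e1 := ler_wpM2l (ltW t0) ec'; have e2 := ler_wpM2l s0 ec.
have e3 := ler_wpM2l (ltW t0) cM'; have e4 := ler_wpM2l s0 cM.
split; [lra | lra |].
have -> : c + t * (c' - c) - eta = (1 - t) * (c - eta) + t * (c' - eta) by ring.
have -> : a + t * (a' - a) = (1 - t) * a + t * a' by ring.
have -> : b + t * (b' - b) = (1 - t) * b + t * b' by ring.
apply: cone_add; try by rewrite mulr_ge0 ?subr_ge0 // ltW.
  by rewrite !exprMn -mulrDr mulrCA ler_wpM2l ?sqr_ge0.
by rewrite !exprMn -mulrDr mulrCA ler_wpM2l ?sqr_ge0.
Qed.

Definition feasible eta x : Prop :=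
  [/\ forall i, ~~ used i -> x 0 i = 0,
      forall l m, interior N l m -> shrunk eta (Xc x l m) (Xa x l m) (Xb x l m) &
      sumP N (Xc x) = sumP N c0].

Lemma feasible_in_cones eta x : 0 < eta -> feasible eta x -> in_cones k x.
Proof. by move=> e0 [_ sx _] l m lm; exact/(shrunk_in_cone e0)/sx. Qed.

Lemma feasible_convex eta x y (t : R) : feasible eta x -> feasible eta y ->
  0 < t <= 1 -> feasible eta (x + t *: (y - x)).
Proof.
move=> [ux sx mx] [uy sy my] t01; split.
- by move=> i iu; rewrite !mxE ux // uy // subr0 mulr0 addr0.
- move=> l m lm; rewrite !getD !getZ !getB.
  exact: shrunk_convex (sx _ _ lm) (sy _ _ lm).
- rewrite (@eq_sumP _ _ _ (fun l m => Xc x l m + t * (Xc y l m - Xc x l m))).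
    by rewrite sumPD sumPZ sumPB mx my subrr mulr0 addr0.
  by move=> l m lm; rewrite getD getZ getB.
Qed.

Local Open Scope classical_set_scope.

Lemma closed_le0 (T : topologicalType) (f : T -> R) :
  (forall z : T, cont_at z f) -> closed [set z | f z <= 0].
Proof.
move=> cf; apply: (@preimage_closed _ _ f [set y | y <= 0]).
  by move=> z _; exact: cf.
exact: closed_le.
Qed.

Lemma feasible_closed eta : closed [set x | feasible eta x].
Proof.
(* Equalities are written as squares at most 0, so that every constraint is a sublevel set of a
   continuous function. *)
pose U i := [set x : vec | x 0 i ^+ 2 <= 0].
pose C1 (p : int * int) := [set x : vec | eta - Xc x p.1 p.2 <= 0].
pose C2 (p : int * int) := [set x : vec | Xc x p.1 p.2 - (M - eta) <= 0].
pose C3 (p : int * int) := [set x : vec |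
  4 * (Xa x p.1 p.2 ^+ 2 + Xb x p.1 p.2 ^+ 2) - (Xc x p.1 p.2 - eta) ^+ 2 <= 0].
pose S := [set x : vec | (sumP N (Xc x) - sumP N c0) ^+ 2 <= 0].
have -> : [set x | feasible eta x] = (\bigcap_(i in [set i | ~~ used i]) U i)
  `&` (\bigcap_(p in [set p | interior N p.1 p.2]) (C1 p `&` C2 p `&` C3 p)) `&` S.
  have sq0 (y : R) : (y ^+ 2 <= 0) = (y == 0).
    by rewrite -sqrf_eq0 eq_le sqr_ge0 andbT.
  apply/seteqP; split=> x /=.
    move=> [ux sx mx]; split; first split.
    - by move=> i /= iu; rewrite /U /= ux // expr0n.
    - by move=> [l m] /= /sx [s1 s2 s3]; rewrite /C1 /C2 /C3 /=; split; first split; lra.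
    - by rewrite /S /= mx subrr expr0n.
  move=> [[ux sx] mx]; split.
  - by move=> i iu; apply/eqP; rewrite -sq0; exact: ux.
  - by move=> l m lm; have [[s1 s2] s3] := sx (l, m) lm; rewrite /C1 /C2 /C3 /= in s1 s2 s3;
      split; lra.
  - by apply/eqP; rewrite -subr_eq0 -sq0.
apply: closedI; first apply: closedI.
- apply: closed_bigI => i _; apply: closed_le0 => x; apply: contX.
  exact: coord_continuous.
- apply: closed_bigI => -[l m] _; apply: closedI; first apply: closedI.
  + by apply: closed_le0 => x; cont_auto; exact: cont_get.
  + by apply: closed_le0 => x; cont_auto; exact: cont_get.
  + by apply: closed_le0 => x; cont_auto; exact: cont_get.
- apply: closed_le0 => x; apply: contX; apply: contD; last exact: cont_cst.
  by apply: cont_sumP => l m _; exact: cont_get.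
Qed.

Lemma feasible_compact eta : 0 < eta -> compact [set x | feasible eta x].
Proof.
move=> e0.
have cB : compact [set v : vec | forall i, `[- M, M] (v ord0 i)].
  by apply: (@rV_compact _ _ (fun=> `[- M, M])) => i; exact: segment_compact.
apply: (@subclosed_compact _ _ _ (@feasible_closed eta) cB).
have [[M0 _] _ _ _ _] := adm.
move=> x [ux sx _] i /=; rewrite in_itv /=.
have [iu|iu] := boolP (used i); last by rewrite ux // oppr_le0 ltW.
have [l [m [t [lm ->]]]] := used_coord x iu.
have [/andP[c1 c2] /andP[a1 a2] /andP[b1 b2]] :=
  in_cone_bounds (shrunk_in_cone e0 (sx l m lm)).
by case: t => [[]|]; apply/andP; split=> //; lra.
Qed.

Local Close Scope classical_set_scope.

Lemma feasible_variational eta : 0 < eta -> (exists x, feasible eta x) ->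
  exists2 x, feasible eta x & forall y, feasible eta y -> 0 <= grad x (y - x).
Proof.
move=> e0 [x1 fx1].
apply: (convex_variational_inequality
  (F := potential k h dt c0 cb Q0 Qb) (feasible_compact e0)).
- by exists x1.
- by move=> x y t fx fy t01; exact: feasible_convex.
- by move=> x y fx fy; apply: potential_convex => //; apply: feasible_in_cones e0 _.
- exact: gradZ.
- move=> x d; apply: contD; apply: cont_sumP => l m lm.
    rewrite (_ : (fun y => _) = (fun y =>
      grad_c k (Xc x l m) (Xa x l m) (Xb x l m) * (Xc d l m + Xc y l m)
      + grad_a k (Xc x l m) (Xa x l m) (Xb x l m) * (Xa d l m + Xa y l m)
      + grad_b k (Xc x l m) (Xa x l m) (Xb x l m) * (Xb d l m + Xb y l m))); last first.
      by apply/funext => y; rewrite /slope !getD.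
    by cont_auto; exact: cont_get.
  rewrite (_ : (fun y => _) = (fun y => fc x l m * (Xc d l m + Xc y l m)
      + fa x l m * (Xa d l m + Xa y l m) + fb x l m * (Xb d l m + Xb y l m))); last first.
    by apply/funext => y; rewrite !getD.
  by cont_auto; exact: cont_get.
- move=> x d e fx; apply: contD; apply: cont_sumP => l m lm.
    rewrite (_ : (fun y => _) = (fun y =>
      grad_c k (Xc y l m) (Xa y l m) (Xb y l m) * (Xc d l m + e * Xc y l m)
      + grad_a k (Xc y l m) (Xa y l m) (Xb y l m) * (Xa d l m + e * Xa y l m)
      + grad_b k (Xc y l m) (Xa y l m) (Xb y l m) * (Xb d l m + e * Xb y l m))); last first.
      by apply/funext => y; rewrite /slope !getD !getZ.
    have [g1 g2 g3] := cont_gradients adm (@cont_get _ _ x None l m)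
      (@cont_get _ _ x (Some false) l m) (@cont_get _ _ x (Some true) l m)
      (feasible_in_cones e0 fx lm).
    by cont_auto; exact: cont_get.
  rewrite (_ : (fun y => _) = (fun y => fc y l m * (Xc d l m + e * Xc y l m)
      + fa y l m * (Xa d l m + e * Xa y l m) + fb y l m * (Xb d l m + e * Xb y l m)));
    last first.
    by apply/funext => y; rewrite !getD !getZ.
  have h1 := @cont_fc _ k N h dt c0 cb Qb x l m.
  have h2 := @cont_fa _ k N h dt c0 cb Q0 Qb x l m.
  have h3 := @cont_fb _ k N h dt c0 cb Q0 Qb x l m.
  by cont_auto; exact: cont_get.
Qed.

(** Only the interior values of the previous step: the ghost values of its [cfield] are recomputed
    by [ghost_ext]. *)
Definition base : vec := vec_of N (fun t => match t with
  | None => c0 | Some false => comp Q0 0 0 | Some true => comp Q0 0 1 end).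

Lemma base_in_cones : in_cones k base.
Proof.
move=> l m lm; rewrite /base !get_vec_of //.
by have /physicalE [] := ph0 lm.
Qed.

(* The bound does not depend on how far [x] is from the boundary of the cones:
   monotonicity bounds the slope towards [base] from above at every node, so a
   large gradient at one node would make the total slope negative. *)
Lemma gradient_bound : exists2 Kb, 0 <= Kb & forall x, in_cones k x ->
  0 <= grad x (base - x) -> forall l m, interior N l m ->
  [/\ `|grad_c k (Xc x l m) (Xa x l m) (Xb x l m)| <= Kb,
      `|grad_a k (Xc x l m) (Xa x l m) (Xb x l m)| <= Kb &
      `|grad_b k (Xc x l m) (Xa x l m) (Xb x l m)| <= Kb].
Proof.
have [[M0 nu0] _ _ _ _] := adm.
have /choice [f Hf] : forall p : int * int, exists y : R * R, interior N p.1 p.2 ->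
    [/\ 0 < y.1, 0 <= y.2 & forall c a b, in_cone k c a b ->
    let s := slope k c a b (Xc base p.1 p.2 - c) (Xa base p.1 p.2 - a)
                           (Xb base p.1 p.2 - b) in
    [/\ y.1 * `|grad_c k c a b| + s <= y.2,
        y.1 * `|grad_a k c a b| + s <= y.2
      & y.1 * `|grad_b k c a b| + s <= y.2]].
  move=> p.
  have [lm|_] := boolP (interior N p.1 p.2); last by exists (0, 0).
  have [rho [C H]] := gradient_le_slope M0 nu0 (base_in_cones lm).
  by exists (rho, C).
pose C2 := sumP N (fun l m => 2 * M * (`|fc base l m| + `|fa base l m| + `|fb base l m|)).
pose C3 := sumP N (fun l m => (f (l, m)).2) + C2.
have C3_ge0 : 0 <= C3.
  apply: addr_ge0; apply: sumP_ge0 => l m lm; first by have [] := Hf (l, m) lm.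
  by rewrite mulr_ge0 ?addr_ge0 // mulr_ge0 // ltW.
(* A sum over the nodes serves as a maximum, its terms being nonnegative. *)
pose Kb := sumP N (fun l m => C3 / (f (l, m)).1).
have Kb_term l m : interior N l m -> 0 <= C3 / (f (l, m)).1.
  by move=> lm; have [r0 _ _] := Hf (l, m) lm; rewrite divr_ge0 // ltW.
exists Kb; first exact: sumP_ge0.
move=> x cx G0 l m lm.
pose s l m := slope k (Xc x l m) (Xa x l m) (Xb x l m) (Xc base l m - Xc x l m)
  (Xa base l m - Xa x l m) (Xb base l m - Xb x l m).
have smooth_le : smooth_grad x (base - x) <= C2.
  have mono := smooth_grad_monotone c0 cb Q0 Qb adm N0 h0 dt0 x base.
  apply: le_trans mono _.
  apply: ler_sumP => l' m' lm'; rewrite !getB.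
  have [/andP[? ?] /andP[? ?] /andP[? ?]] := in_cone_bounds (cx _ _ lm').
  have [/andP[? ?] /andP[? ?] /andP[? ?]] := in_cone_bounds (base_in_cones lm').
  have -> : 2 * M * (`|fc base l' m'| + `|fa base l' m'| + `|fb base l' m'|)
    = `|fc base l' m'| * (2 * M) + `|fa base l' m'| * (2 * M)
      + `|fb base l' m'| * (2 * M) by ring.
  by apply: lerD; [apply: lerD|]; apply: ler_mul_norm; apply/andP; split; lra.
have sum_s : - sumP N s <= C2.
  have sE : slope_grad x (base - x) = sumP N s.
    by apply: eq_sumP => l' m' _; rewrite /s !getB.
  by move: G0; rewrite /grad sE; lra.
have gap_ge0 l' m' : interior N l' m' -> 0 <= (f (l', m')).2 - s l' m'.
  move=> lm'; have [r0 _ H] := Hf (l', m') lm'.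
  have [H1 _ _] := H _ _ _ (cx _ _ lm').
  rewrite subr_ge0; apply: le_trans H1; rewrite lerDr.
  by rewrite mulr_ge0 // ltW.
(* The gaps are nonnegative at all nodes and add up to at most [C3], so each of them is at most
   [C3]. *)
have gap_le : (f (l, m)).2 - s l m <= C3.
  apply: le_trans (sumP_ge_node gap_ge0 lm) _.
  by rewrite sumPB /C3; lra.
have [r0 _ H] := Hf (l, m) lm.
have [H1 H2 H3] := H _ _ _ (cx _ _ lm).
have KbE : C3 / (f (l, m)).1 <= Kb := sumP_ge_node Kb_term lm.
rewrite -/(s l m) in H1 H2 H3.
by split; apply: le_trans KbE; rewrite ler_pdivlMr // mulrC; lra.
Qed.

(** The margin between [2 eta] and [eta] leaves room for a small step along any direction of zero
    mass and along its opposite, so the variational inequality becomes an equality. *)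
Lemma stationary eta x (f : option bool -> gridfun R) : 0 < eta ->
  feasible (2 * eta) x ->
  (forall y, feasible eta y -> 0 <= grad x (y - x)) ->
  sumP N (f None) = 0 -> grad x (vec_of N f) = 0.
Proof.
move=> e0 [ux sx mx] VI f0.
suff ge0 g : sumP N (g None) = 0 -> 0 <= grad x (vec_of N g).
  apply/eqP; rewrite eq_le ge0 // andbT.
  have : 0 <= grad x (vec_of N (fun t l m => - f t l m)).
    by apply: ge0; rewrite sumPN f0 oppr0.
  have -> : vec_of N (fun t l m => - f t l m) = (-1) *: vec_of N f.
    apply/rowP => i; rewrite !mxE; case: (enum_val i) => -[p q] t /=.
    by case: ifP => _; rewrite mulN1r ?oppr0.
  by rewrite gradZ mulN1r oppr_ge0.
move=> g0.
(* Dominates every component of [g] at every interior node, so steps of length [t] stay within the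
   [eta / 4] allowed by [shrunk_add]; the 1 makes it positive. *)
pose B := 1 + sumP N (fun l m => `|g None l m| + `|g (Some false) l m| + `|g (Some true) l m|).
have B0 : 0 < B by rewrite ltr_wpDr // sumP_ge0 // => l m _; rewrite !addr_ge0.
pose t := eta / 4 / B.
have t0 : 0 < t by rewrite !divr_gt0.
have small l m o : interior N l m -> `|t * g o l m| <= eta / 4.
  move=> lm; rewrite normrM gtr0_norm // /t mulrAC ler_pdivrMr //.
  rewrite ler_wpM2l //; first by rewrite divr_ge0 // ltW.
  have H : `|g None l m| + `|g (Some false) l m| + `|g (Some true) l m| <= B - 1.
    rewrite /B (addrC 1) addrK; apply: (sumP_ge_node (f := fun l m =>
      `|g None l m| + `|g (Some false) l m| + `|g (Some true) l m|)) => // l' m' _.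
    by rewrite !addr_ge0.
  have := normr_ge0 (g None l m); have := normr_ge0 (g (Some false) l m).
  have := normr_ge0 (g (Some true) l m).
  by case: o => [[]|]; lra.
have : 0 <= grad x (x + t *: vec_of N g - x).
  apply: VI; split.
  - move=> i iu; have -> : (x + t *: vec_of N g) 0 i = x 0 i + t * vec_of N g 0 i.
      by rewrite !mxE.
    by rewrite ux // vec_of_unused // mulr0 addr0.
  - move=> l m lm; rewrite !getD !getZ !get_vec_of //.
    by apply: shrunk_add => //; [exact: sx | exact: small | exact: small | exact: small].
  - rewrite (@eq_sumP _ _ _ (fun l m => Xc x l m + t * g None l m)).
      by rewrite sumPD sumPZ g0 mulr0 addr0.
    by move=> l m lm; rewrite getD getZ get_vec_of.
by rewrite addrC addKr gradZ pmulr_rge0.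
Qed.

Lemma sumP_sqr_eq0 (u : gridfun R) l m : sumP N (fun l m => u l m * u l m) = 0 ->
  interior N l m -> u l m = 0.
Proof.
move=> u0 lm; apply/eqP; rewrite -sqrf_eq0 eq_le sqr_ge0 andbT -u0 expr2.
apply: (sumP_ge_node (f := fun l m => u l m * u l m)) => // l' m' _.
by rewrite -expr2 sqr_ge0.
Qed.

(** Each equation is tested with its own left-hand side, which makes a sum of squares vanish; for c
    this is the mean-free part [Ghat N T], an admissible direction. *)
Lemma stationary_scheme x : in_cones k x -> sumP N (Xc x) = sumP N c0 ->
  (forall f : option bool -> gridfun R, sumP N (f None) = 0 ->
     grad x (vec_of N f) = 0) ->
  scheme k N h dt cb Qb c0 Q0 (cfield x) (Qnode x).
Proof.
move=> cx mx st.
pose gc l m := grad_c k (Xc x l m) (Xa x l m) (Xb x l m).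
pose ga l m := grad_a k (Xc x l m) (Xa x l m) (Xb x l m).
pose gb l m := grad_b k (Xc x l m) (Xa x l m) (Xb x l m).
have gradF (f : option bool -> gridfun R) : grad x (vec_of N f) = sumP N (fun l m =>
    (gc l m + fc x l m) * f None l m + (ga l m + fa x l m) * f (Some false) l m
    + (gb l m + fb x l m) * f (Some true) l m).
  rewrite /grad /slope_grad /smooth_grad -sumPD; apply: eq_sumP => l m lm.
  by rewrite !get_vec_of // /slope -/(gc l m) -/(ga l m) -/(gb l m); ring.
pose T l m := gc l m + fc x l m.
have eqc l m : interior N l m -> Ghat N T l m = 0.
  apply: sumP_sqr_eq0; rewrite sumP_GhatM ?sumP_Ghat //.
  have := st (fun t => if t is None then Ghat N T else fun _ _ => 0) (sumP_Ghat N T).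
  by rewrite gradF => E; rewrite -[RHS]E; apply: eq_sumP => l' m' _; rewrite /T; ring.
have eqa l m : interior N l m -> ga l m + fa x l m = 0.
  apply: (sumP_sqr_eq0 (u := fun l m => ga l m + fa x l m)).
  have := st (fun t => if t is Some false then fun l m => ga l m + fa x l m
    else fun _ _ => 0) (sumP0 R N).
  by rewrite gradF => E; rewrite -[RHS]E; apply: eq_sumP => l' m' _; ring.
have eqb l m : interior N l m -> gb l m + fb x l m = 0.
  apply: (sumP_sqr_eq0 (u := fun l m => gb l m + fb x l m)).
  have := st (fun t => if t is Some true then fun l m => gb l m + fb x l m
    else fun _ _ => 0) (sumP0 R N).
  by rewrite gradF => E; rewrite -[RHS]E; apply: eq_sumP => l' m' _; ring.
have dn : dt != 0 by rewrite gt_eqF.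
split.
- exact: in_cones_physical.
- move=> l m lm; set mu := (X in Ghat N X).
  have TE l' m' : interior N l' m' ->
      T l' m' = mu l' m' + dt^-1 * (cfield x l' m' - c0 l' m').
    move=> lm'; have cab := cx l' m' lm'.
    rewrite /T /mu /gc cfield_interior // Qnode_interior //.
    rewrite dXi_dc_qmat // /fc /force_c cfield_interior //.
    by ring.
  (* The difference quotient has zero total by conservation of mass, so [Ghat] subtracts the same
     mean from [T] and from [mu]. *)
  have sumT : sumP N T = sumP N mu.
    rewrite (eq_sumP TE) sumPD sumPZ sumPB.
    rewrite (@eq_sumP _ _ (cfield x) (Xc x)); last by move=> *; exact: cfield_interior.
    by rewrite mx subrr mulr0 addr0.
  have := eqc l m lm; rewrite /Ghat sumT TE // => E.
  by apply/eqP; rewrite -addr_eq0; apply/eqP; rewrite -[RHS]E; ring.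
- move=> l m lm i j; set mu := \matrix_(_, _) _.
  have cab := cx l m lm.
  have /physicalE [Q0E _] := ph0 lm.
  have QE := Qnode_interior Qb x lm.
  have muE a b : mu a b = dXi_dQ k (Xc x l m) (qmat (Xa x l m) (Xb x l m)) a b
      + 2 * c02 k * Q0 l m a b + LQ k h (cfield x) (Qnode x) a b l m.
    by rewrite /mu mxE cfield_interior // QE.
  (* The factor 2 appears because the difference quotient of a sits in both diagonal entries. *)
  have Ea : (mu 0 0 - mu 1 1) + (2 / dt) * (Xa x l m - Q0 l m 0 0) = 0.
    rewrite -[RHS](eqa l m lm) /ga -(dXi_dQ_qmat_diag cab) !muE /fa /force_Q !mxE QE.
    by rewrite Q0E !mxE /=; field.
  have Eb : (mu 0 1 + mu 1 0) + (2 / dt) * (Xb x l m - Q0 l m 0 1) = 0.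
    rewrite -[RHS](eqb l m lm) /gb -(dXi_dQ_qmat_offdiag cab) !muE /fb /force_Q !mxE QE.
    by rewrite Q0E !mxE /=; field.
  have {}Ea : (Xa x l m - Q0 l m 0 0) / dt = - ((mu 0 0 - mu 1 1) / 2).
    apply/eqP; rewrite -subr_eq0 opprK; apply/eqP.
    by rewrite -[RHS](mulr0 (2^-1)) -Ea; field.
  have {}Eb : (Xb x l m - Q0 l m 0 1) / dt = - ((mu 0 1 + mu 1 0) / 2).
    apply/eqP; rewrite -subr_eq0 opprK; apply/eqP.
    by rewrite -[RHS](mulr0 (2^-1)) -Eb; field.
  have symE a b : symtl mu a b
    = (mu a b + mu b a) / 2 - (a == b)%:R / 2 * (mu 0 0 + mu 1 1).
    by rewrite mxE sum_ord2.
  rewrite QE symE; move: mu muE Ea Eb symE => mu _ Ea Eb _.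
  rewrite Q0E; case: (ord2P i) (ord2P j) => -> [] ->; rewrite !mxE /=.
  + by rewrite Ea; field.
  + by rewrite Eb; field.
  + by rewrite Eb; field.
  + by rewrite -opprD mulNr Ea; field.
- exact: ghost_ext_boundary_step.
- exact: fields_bnodes.
Qed.

Lemma scheme_exists : exists c1 Q1, scheme k N h dt cb Qb c0 Q0 c1 Q1.
Proof.
have [[M0 nu0] _ _ _ _] := adm.
have [Kb Kb0 bound] := gradient_bound.
have [eta2 eta2_gt0 coercive] := slope_coercive M0 nu0 Kb0.
pose eta := eta2 / 2.
have e0 : 0 < eta by rewrite divr_gt0.
have e2 : 2 * eta = eta2 by rewrite /eta; field.
have shrink x : in_cones k x -> 0 <= grad x (base - x) ->
    forall l m, interior N l m -> shrunk (2 * eta) (Xc x l m) (Xa x l m) (Xb x l m).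
  move=> cx G0 l m lm; rewrite e2.
  have [b1 b2 b3] := bound x cx G0 l m lm.
  exact: coercive (cx l m lm) b1 b2 b3.
have mass_base : sumP N (Xc base) = sumP N c0.
  by apply: eq_sumP => l m lm; rewrite /base get_vec_of.
have fbase : feasible eta base.
  split=> //; first exact: vec_of_unused.
  move=> l m lm.
  (* The bound applies to [base] itself, whose slope towards itself is 0; adding zero increments
     then passes from [2 eta] to [eta]. *)
  have := shrink base base_in_cones; rewrite subrr -(scale0r (0 : vec)) gradZ mul0r.
  move=> /(_ (lexx _) l m lm) sb.
  by have := @shrunk_add eta _ _ _ 0 0 0 e0 sb; rewrite !addr0 normr0; apply;
    rewrite divr_ge0 // ltW.
have [x fx VI] := feasible_variational e0 (ex_intro _ base fbase).
have cx := feasible_in_cones e0 fx.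
have fx2 : feasible (2 * eta) x.
  by have [ux sx mx] := fx; split=> //; exact: shrink cx (VI _ fbase).
exists (cfield x), (Qnode x); apply: stationary_scheme => //.
  by have [] := fx.
by move=> f f0; exact: stationary e0 fx2 VI f0.
Qed.

End Existence.

Theorem theorem3p11 (R : realType) (k : coeffs R) (L : R) (N : nat) (dt : R)
    (A : gridfun R -> gridfun 'M[R]_2 -> R)
    (cb c0 : gridfun R) (Qb Q0 : gridfun 'M[R]_2) :
  admissible k -> 0 < L -> (0 < N)%N -> 0 < dt ->
  boundary_determined N A ->
  physical_inside k N c0 Q0 ->
  eq_on_bnodes N c0 Q0 cb Qb ->
  let h := L / N%:R in
  [/\ exists c1 Q1, scheme k N h dt cb Qb c0 Q0 c1 Q1,
      forall c1 Q1 c1' Q1',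
        scheme k N h dt cb Qb c0 Q0 c1 Q1 ->
        scheme k N h dt cb Qb c0 Q0 c1' Q1' ->
        same_data N h c1 Q1 c1' Q1' &
      forall c1 Q1, scheme k N h dt cb Qb c0 Q0 c1 Q1 ->
        energy_law k N h dt A c0 Q0 c1 Q1].
Proof.
move=> adm L0 N0 dt0 bA ph0 eqb0 h.
have h0 : 0 < h by rewrite divr_gt0 // ltr0n.
split.
- exact: scheme_exists.
- by move=> c1 Q1 c1' Q1'; exact: scheme_unique.
- by move=> c1 Q1; exact: scheme_energy_law.
Qed.
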